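(* Let $a$ be an integer, $T$ a positive real, $x\in\mathbb Q_p$ and $y\in B_a+x$. For all $t\in(0,T]$, \[P_{t,x,y}\big(\|X-x\|_T\le p^a\big)\ge P_x\big(\|X-x\|_T\le p^a\big),\qquad \|X-x\|_T=\sup_{0\le s\le T}|X_s-x|.\]
   Context: Fix a prime $p$. $\mathbb Q_p$ has absolute value $|\cdot|$ and Haar measure $\mu$ with $\mu(\mathbb Z_p)=1$ (write $dx$). $B_k(x)=\{w\in\mathbb Q_p:|w-x|\le p^k\}$, $B_k=B_k(0)$. For $x\in\mathbb Q_p$ with $p$-adic digits $a_x(k)$, $\{x\}=\sum_{k<0}a_x(k)p^k$ and $\chi(x)=e^{2\pi i\{x\}}$. Fix positive reals $b,\sigma$. For $t>0$, $\rho(t,x)=\int_{\mathbb Q_p}\chi(xy)e^{-\sigma t|y|^b}\,dy$ (a probability density, the fundamental solution of the diffusion equation for the Vladimirov operator of exponent $b$ with diffusion constant $\sigma$). $P$ is the probability measure on the Skorokhod space $D([0,\infty):\mathbb Q_p)$ of càdlàg paths, concentrated on paths starting at $0$, with finite-dimensional distributions $P(X_{t_1}\in U_1,\dots,X_{t_k}\in U_k)=\int_{U_1}\cdots\int_{U_k}\prod_{i=1}^k\rho(t_i-t_{i-1},x_i-x_{i-1})\,dx_k\cdots dx_1$ for $0=t_0<t_1<\dots<t_k$, $x_0=0$; $X_t(\omega)=\omega(t)$. For $x\in\mathbb Q_p$, $P_x(A)=P(A-x)$ for cylinder sets $A$ (process started at $x$). For $t>0$ and $x,y\in\mathbb Q_p$,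 $P_{t,x,y}$ is the $p$-adic Brownian bridge measure: the measure $P_x$ conditioned on $X_t=y$, i.e. $P_{t,x,y}(A)=\lim_{n\to\infty}P_x(A\mid X_t\in B_{-n}(y))$; it is concentrated on paths starting at $x$ and taking the value $y$ at time $t$. *)

(* Defs.v *)
From HB Require Import structures.
From mathcomp Require Import all_boot all_order all_algebra.
From mathcomp Require Import all_classical all_reals all_analysis.
Set Implicit Arguments. Unset Strict Implicit. Unset Printing Implicit Defensive.
Import Order.TTheory GRing.Theory Num.Theory.
Import numFieldNormedType.Exports.
Local Open Scope classical_set_scope.
Local Open Scope ring_scope.

(* The p-adic numbers Q_p, represented by their (unique) p-adic digit       *)
(* expansions  x = sum_{k in Z} a_x(k) p^k , digits in {0,..,p-1},          *)
(* a_x(k) = 0 for all sufficiently negative k.                              *)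
Section Padic.
Variable p : nat.

Definition is_padic (d : int -> nat) : Prop :=
  (forall k, (d k <= p.-1)%N) /\ exists m : int, forall k, k < m -> d k = 0%N.

Definition Qp := {d : int -> nat | is_padic d}.

Definition digit (x : Qp) (k : int) : nat := proj1_sig x k.

Lemma is_padic0 : is_padic (fun _ => 0%N).
Proof. by split=> //; exists 0. Qed.

Definition Qp0 : Qp := exist _ (fun _ => 0%N) is_padic0.

(* packaging a digit function (only ever applied to valid digit functions) *)
Definition Qp_of (d : int -> nat) : Qp :=
  match pselect (is_padic d) with
  | left H => exist _ d H
  | right _ => Qp0
  end.

Definition lowb (x : Qp) : int :=
  Num.min 0 (proj1_sig (cid (proj2 (proj2_sig x)))).

Definition trunc (n : int) (x : Qp) : rat :=
  \sum_(i < absz (Num.max (0 : int) (n - lowb x)))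
     (digit x (lowb x + i%:Z))%:R * (p%:Q) ^ (lowb x + i%:Z).

Definition digit_of (q : rat) (k : int) : nat :=
  absz (Num.floor (q * (p%:Q) ^ (- k)) %% p%:Z)%Z.

Definition Qp_add (x y : Qp) : Qp :=
  Qp_of (fun k => digit_of (trunc (k + 1) x + trunc (k + 1) y) k).
Definition Qp_opp (x : Qp) : Qp :=
  Qp_of (fun k => digit_of ((p%:Q) ^ (k + 1) - trunc (k + 1) x) k).
Definition Qp_sub (x y : Qp) : Qp := Qp_add x (Qp_opp y).
Definition Qp_mul (x y : Qp) : Qp :=
  Qp_of (fun k => let N := ((absz k)%:Z + 1 - lowb x - lowb y)%R in
                  digit_of (trunc N x * trunc N y) k).

Definition Qp_frac (x : Qp) : rat := trunc 0 x.

Section Real.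
Variable R : realType.

Definition Qp_abs (x : Qp) : R :=
  match pselect (exists k : int, digit x k <> 0%N /\
                   forall j, j < k -> digit x j = 0%N) with
  | left H => (p%:R : R) ^ (- proj1_sig (cid H))
  | right _ => 0
  end.

Definition Qp_ball (k : int) (x : Qp) : set Qp :=
  [set w | Qp_abs (Qp_sub w x) <= (p%:R : R) ^ k].

Definition Qp_borel : set (set Qp) :=
  <<s [set A | exists (k : int) (x : Qp), A = Qp_ball k x] >>.

(* Haar measure: the image of Lebesgue measure on [0,+oo) under the base-p  *)
(* digit map t |-> sum_k a_k p^k with a_k = floor(t p^{k+1}) mod p, i.e.    *)
(* the p-adic number whose digits are the real base-p digits of t read in   *)
(* reverse order.  It is translation invariant with mu(Z_p) = 1.           *)
Definition Qp_of_real (t : R) : Qp :=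
  Qp_of (fun k => absz (Num.floor (t * (p%:R : R) ^ (k + 1)) %% p%:Z)%Z).

Definition haar_integral (f : Qp -> \bar R) : \bar R :=
  (\int[@lebesgue_measure R]_(t in `[0%R, +oo[) f (Qp_of_real t))%E.

(* additive character chi(x) = exp(2 pi i {x}); we only need its real part *)
Definition chi_re (x : Qp) : R := cos (2 * pi * ratr (Qp_frac x)).

(* heat kernel rho(t,x) = int chi(x y) exp(-sigma t |y|^b) dy  (real valued; *)
(* the imaginary part vanishes by the symmetry y |-> -y)                    *)
Definition rho (b sigma : R) (t : R) (x : Qp) : R :=
  fine (haar_integral (fun y =>
    (chi_re (Qp_mul x y) * expR (- (sigma * t * (Qp_abs y `^ b))))%:E)).

Fixpoint fdd_integral (b sigma : R) (s0 : R) (x0 : Qp)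
    (l : seq (R * set Qp)) {struct l} : \bar R :=
  match l with
  | [::] => 1%E
  | (t, U) :: l' => haar_integral (fun x =>
       ((\1_U x * rho b sigma (t - s0) (Qp_sub x x0))%:E
         * fdd_integral b sigma t x l')%E)
  end.

(* x and y agree in all digits of index < n, i.e. |x - y| <= p^{-n} *)
Definition Qp_close (n : int) (x y : Qp) : Prop :=
  forall k, k < n -> digit x k = digit y k.

(* paths are functions R -> Q_p, extended to negative times by w s = w 0 *)
Definition cadlag (w : R -> Qp) : Prop :=
  [/\ (forall s, s < 0 -> w s = w 0),
      (forall t, 0 <= t -> forall n : int, exists2 d : R, 0 < d &
          forall s, t <= s < t + d -> Qp_close n (w s) (w t))
    & (forall t, 0 < t -> exists l : Qp, forall n : int, exists2 d : R, 0 < d &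
          forall s, t - d < s < t -> Qp_close n (w s) l)].

Definition Dsp := {w : R -> Qp | cadlag w}.

Lemma cadlag_cst : cadlag (fun _ => Qp0).
Proof.
split=> //.
- by move=> t _ n; exists 1 => // s _ k.
- by move=> t _; exists Qp0 => n; exists 1 => // s _ k.
Qed.

HB.instance Definition _ := gen_eqMixin Dsp.
HB.instance Definition _ := gen_choiceMixin Dsp.
HB.instance Definition _ := isPointed.Build Dsp (exist _ _ cadlag_cst).

Definition Xt (t : R) (w : Dsp) : Qp := proj1_sig w t.

(* cylinder (= Skorokhod Borel) sigma-algebra generated by the evaluations *)
Definition cylinders : set (set Dsp) :=
  [set A | exists (t : R) (U : set Qp), Qp_borel U /\ A = [set w | U (Xt t w)]].

Definition Dmeas := g_sigma_algebraType cylinders.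

Definition Pstart (P : set Dmeas -> \bar R) (x : Qp) (A : set Dmeas) : \bar R :=
  P [set w' : Dmeas | exists2 w : Dmeas, A w &
                        forall s, Xt s w = Qp_add (Xt s w') x].

Definition supnorm (T : R) (x : Qp) (w : Dsp) : R :=
  sup [set Qp_abs (Qp_sub (Xt s w) x) | s in `[0, T]].

(* P_{t,x,y}(A) as the limit of P_x(A | X_t in B_{-n}(y)) *)
Definition bridge_approx (P : set Dmeas -> \bar R) (t : R) (x y : Qp)
    (A : set Dmeas) (n : nat) : R :=
  fine (Pstart P x (A `&` [set w | Qp_ball (- n%:Z) y (Xt t w)]))
  / fine (Pstart P x [set w | Qp_ball (- n%:Z) y (Xt t w)]).

End Real.
End Padic.

(* Main.v *)
Require Import Defs.
From HB Require Import structures.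
From mathcomp Require Import all_boot all_order all_algebra.
From mathcomp Require Import all_classical all_reals all_analysis.
From mathcomp Require Import measurable_realfun ring lra zify.
Import Order.TTheory GRing.Theory Num.Theory.
Import numFieldNormedType.Exports.
Local Open Scope classical_set_scope.
Local Open Scope ring_scope.

(* Translating by [x] we may start at [0], with [y] in the ball [B] of radius
   [p^a].  By the ultrametric inequality a path that is outside [B] at some
   time sees all points of [B] at the same distance, so if it comes back to [B]
   it is uniformly distributed there when it does.  Write [S] for the
   probability of [X_t \in B], [c] for that of staying in [B] on [[0, t]], [C]
   for that of staying in [B] on [[t, T]] given [X_t \in B] (it does not depend
   on [X_t]), and [r] for [p^a * rho t y].  Then the bridge stays in [B] with
   probability [C (1 - (S - c) / r)] and the free process with probability
   [C c], so that the claim becomes [S - c <= r (1 - c)].  It holds because [r]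
   is at least [S - e] with [e <= exp (- u)] where [u := sigma t p^(-ab)], while
   [S] is the mean of [exp (- sigma t |z|^b)] over [|z| <= p^(-a)], and
   [c >= exp (- m u)] by Jensen's inequality, [m] being the mean of
   [|z|^b / p^(-ab)]. *)

Set Implicit Arguments. Unset Strict Implicit.

(** The formula for [S] is Parseval's identity: the transform of the indicator of the ball of radius
    [p^a] is [p^a] times that of the ball of radius [p^(-a)]. The bound on [r] comes from [rho t]
    decreasing in [|y|]: on the ball it is least where [|y| = p^a], and there
    [p^a * rho t y = S - e] with [e = exp (- sigma t p^((1-a)b))]. Replacing [r] by [S - exp (- u)]
    turns the claim into [exp (- u) (1 - c) <= c (1 - S)]. Two chords of [exp] with the same weight
    [m] meet here: [S <= 1 - m (1 - exp (- u))], and [1 / c <= exp (m u) <= 1 + m (exp u - 1)];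
    multiplying the second by [exp (- u)] gives the gap in the first. The uniform return and the
    factor [C] are statements about conditioning on the past, while only iterated integrals over
    finitely many times are given. They are therefore proved as exact identities on finite grids,
    where each inner integral is constant on the ball or depends only on the distance to it; dyadic
    refinement and right continuity then give continuous time. *)

(** Digit indices have no least element, but every expansion vanishes on a half-line of low indices,
    which serves as the base case. *)
Lemma int_ind_up (Q : int -> Prop) (m : int) :
  (forall n, n <= m -> Q n) -> (forall n, Q n -> Q (n + 1)) -> forall n, Q n.
Proof.
move=> Qlow QS n.
have Qm (k : nat) : Q (m + k%:Z).
  elim: k => [|k ih]; first by apply: Qlow; lia.
  by rewrite -addn1 PoszD addrA; exact: QS.
have [/Qlow //|mn] := leP n m.
have -> : n = m + (absz (n - m))%:Z by lia.
exact: Qm.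
Qed.

Lemma floorM_nat (F : archiRealFieldType) (p : nat) (y : F) : (0 < p)%N ->
  (Num.floor (y * p%:R) %/ p%:Z)%Z = Num.floor y.
Proof.
move=> p0; have p0' : (0 < p%:Z)%R by lia.
apply/eqP; rewrite eq_le; apply/andP; split.
  rewrite -ltzD1 ltz_divLR // floor_lt_int rmorphM /= ltr_pM2r ?ltr0n //.
  by rewrite floorD1_gt.
rewrite lez_divRL // floor_ge_int rmorphM /= ler_pM2r ?ltr0n //.
exact: floor_le.
Qed.

Lemma modz_absz (m : int) (p : nat) : (0 < p)%N ->
  (absz (m %% p%:Z)%Z)%:Z = (m %% p%:Z)%Z.
Proof. by move=> p0; rewrite gez0_abs // modz_ge0 //; lia. Qed.

(** * Arithmetic of digit expansions *)

Section PadicArithmetic.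
Variable p : nat.
Hypothesis p1 : (1 < p)%N.
Let p0 : (0 < p)%N := ltnW p1.
Let pQ_gt0 : 0 < p%:Q. Proof. by rewrite ltr0n. Qed.
Let pQ_neq0 : p%:Q != 0. Proof. by rewrite gt_eqF. Qed.
Implicit Types (x y z : Qp p) (m n k : int) (q r : rat).

(* [pZ n] is the subgroup p^n Z of the rationals. *)
Definition pZ n q : bool := q * p%:Q ^ (- n) \is a Num.int.

Lemma pZ_D n q r : pZ n q -> pZ n r -> pZ n (q + r).
Proof. by rewrite /pZ mulrDl => *; exact: rpredD. Qed.

Lemma pZ_N n q : pZ n (- q) = pZ n q.
Proof. by rewrite /pZ mulNr rpredN. Qed.

Lemma pZ_B n q r : pZ n q -> pZ n r -> pZ n (q - r).
Proof. by move=> ? ?; apply: pZ_D => //; rewrite pZ_N. Qed.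

Lemma pZ_0 n : pZ n 0. Proof. by rewrite /pZ mul0r rpred0. Qed.

Lemma pZ_M m n q r : pZ m q -> pZ n r -> pZ (m + n) (q * r).
Proof.
rewrite /pZ => hq hr; rewrite opprD expfzDr // mulrACA; exact: rpredM.
Qed.

Lemma pZ_exp n m : m <= n -> pZ m (p%:Q ^ n).
Proof.
move=> mn; rewrite /pZ -expfzDr //.
have -> : n - m = (absz (n - m))%:Z by lia.
by rewrite rpredX // natr_int.
Qed.

Lemma pZ_le n m q : m <= n -> pZ n q -> pZ m q.
Proof.
move=> mn hq; have := pZ_M hq (@pZ_exp (n - n) (m - n) _).
rewrite subrr mulr1 (_ : n + (m - n) = m); last by lia.
by apply; lia.
Qed.

Lemma pZ_int n m (c : nat) : m <= n -> pZ m (c%:R * p%:Q ^ n).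
Proof.
move=> mn; rewrite -[m]add0r; apply: pZ_M; last exact: pZ_exp.
by rewrite /pZ oppr0 expr0z mulr1 natr_int.
Qed.

Lemma pZ_small n q : pZ n q -> 0 <= q < p%:Q ^ n -> q = 0.
Proof.
move=> /intrP[c hc] /andP[q0 qn].
have qE : q = c%:~R * p%:Q ^ n by rewrite -hc -mulrA -expfzDr // addNr mulr1.
have pn := exprz_gt0 n pQ_gt0.
move: q0 qn; rewrite qE pmulr_lge0 // -{2}[_ ^ n]mul1r ltr_pM2r //.
rewrite ler0z ltrz1 => c0 c1; have -> : c = 0 by lia.
by rewrite mul0r.
Qed.

Lemma pZ_uniq n q r : pZ n (q - r) -> 0 <= q < p%:Q ^ n ->
  0 <= r < p%:Q ^ n -> q = r.
Proof.
wlog qr : q r / r <= q => [hw h hq hr|h /andP[q0 q1] /andP[r0 r1]].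
  have [?|/ltW ?] := leP r q; first exact: hw.
  by apply/esym/hw => //; rewrite -pZ_N opprB.
by apply/eqP; rewrite -subr_eq0; apply/eqP/(pZ_small h); lra.
Qed.

(** The representative of [q] modulo p^n Z in [0, p^n); by [premS] it accumulates the digits that
    [digit_of] reads. *)
Definition prem n q : rat := q - p%:Q ^ n * (Num.floor (q * p%:Q ^ (- n)))%:~R.

Lemma prem_itv n q : 0 <= prem n q < p%:Q ^ n.
Proof.
rewrite /prem; have /andP[h1 h2] := floor_itv (q * p%:Q ^ (- n)).
have pn := exprz_gt0 n pQ_gt0.
have : q = p%:Q ^ n * (q * p%:Q ^ (- n)).
  by rewrite mulrCA -expfzDr // subrr mulr1.
move: h1 h2; rewrite intrD; move: (_ * _ ^ (- n)) => u h1 h2 ->.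
by rewrite -mulrBr pmulr_rge0 // -[X in _ < X]mulr1 ltr_pM2l //; lra.
Qed.

Lemma prem_pZ n q : pZ n (prem n q - q).
Proof.
rewrite /prem addrAC subrr sub0r pZ_N /pZ mulrAC -expfzDr // subrr mul1r.
exact: intr_int.
Qed.

Lemma prem_id n q : 0 <= q < p%:Q ^ n -> prem n q = q.
Proof. by move=> h; apply: (pZ_uniq (prem_pZ n q)) => //; exact: prem_itv. Qed.

Lemma prem_eq n q r : pZ n (q - r) -> prem n q = prem n r.
Proof.
move=> h; apply: (@pZ_uniq n); rewrite ?prem_itv //.
have -> : prem n q - prem n r = (prem n q - q) - (prem n r - r) + (q - r) by ring.
apply: pZ_D => //; apply: pZ_B; exact: prem_pZ.
Qed.

Lemma prem_eq0 n q : pZ n q -> prem n q = 0.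
Proof.
move=> h; rewrite (@prem_eq n q 0) ?subr0 // prem_id // lexx /=.
exact: exprz_gt0.
Qed.

Lemma premS n q : prem (n + 1) q = prem n q + (digit_of p q n)%:R * p%:Q ^ n.
Proof.
rewrite /prem /digit_of pmulrn modz_absz //.
have h : q * p%:Q ^ (- n) = (q * p%:Q ^ (- (n + 1))) * p%:R.
  by rewrite -mulrA -[p%:R]/(p%:Q ^ 1) -expfzDr // opprD subrK.
have := divz_eq (Num.floor (q * p%:Q ^ (- n))) p%:Z.
rewrite {2}h floorM_nat // => /(congr1 (fun i : int => i%:~R : rat)).
rewrite intrD intrM => ->; rewrite expfzDr // expr1z.
move: ((Num.floor _)%:~R : rat) => u; move: ((_ %% _)%Z%:~R : rat) => v.
by ring.
Qed.

Lemma digit_of_le q n : (digit_of p q n <= p.-1)%N.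
Proof.
have := @ltz_pmod (Num.floor (q * p%:Q ^ (- n))) p%:Z; rewrite /digit_of.
by have := modz_absz (Num.floor (q * p%:Q ^ (- n))) p0; lia.
Qed.

Lemma digit_le x n : (digit x n <= p.-1)%N.
Proof. by case: x => d [h ?]; exact: h. Qed.

Lemma lowb_le0 x : lowb x <= 0.
Proof. by rewrite /lowb ge_min lexx. Qed.

Lemma digit_lowb x n : n < lowb x -> digit x n = 0%N.
Proof.
by rewrite /lowb; case: cid => m /= hm; rewrite lt_min => /andP[_ /hm].
Qed.

Lemma trunc_low n x : n <= lowb x -> trunc n x = 0.
Proof.
by move=> h; rewrite /trunc max_l ?subr_le0 // big_ord0.
Qed.

Lemma truncS n x : trunc (n + 1) x = trunc n x + (digit x n)%:R * p%:Q ^ n.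
Proof.
have [nlt|lln] := ltP n (lowb x).
  by rewrite !trunc_low ?digit_lowb ?mul0r ?addr0 //; lia.
rewrite /trunc; set N := absz (Num.max _ (n - _)).
have -> : absz (Num.max (0 : int) (n + 1 - lowb x)) = N.+1.
  by rewrite /N !max_r; lia.
rewrite big_ord_recr /=; have -> // : lowb x + N%:Z = n.
by rewrite /N max_r; lia.
Qed.

Lemma trunc_itv n x : 0 <= trunc n x < p%:Q ^ n.
Proof.
apply: (@int_ind_up (fun n => 0 <= trunc n x < p%:Q ^ n) (lowb x)) n => [n ?|n /andP[h1 h2]].
  by rewrite trunc_low // lexx exprz_gt0.
have pn := exprz_gt0 n pQ_gt0.
rewrite truncS addr_ge0 ?mulr_ge0 ?ler0n ?(ltW pn) //=.
have : (digit x n)%:R * p%:Q ^ n <= (p%:Q - 1) * p%:Q ^ n.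
  rewrite ler_pM2r // -[1]/(1%:R) -natrB // ler_nat; have := digit_le x n; lia.
by rewrite expfzDr // expr1z; lra.
Qed.

Lemma trunc_pZ x n m : (forall k, k < m -> digit x k = 0%N) -> pZ m (trunc n x).
Proof.
move=> h; apply: (@int_ind_up (fun n => pZ m (trunc n x)) (lowb x)) n => [n ?|n ih].
  by rewrite trunc_low // pZ_0.
rewrite truncS; apply: pZ_D => //; have [/h ->|?] := ltP n m.
  by rewrite mul0r pZ_0.
exact: pZ_int.
Qed.

Lemma trunc_cong x n m : m <= n -> pZ m (trunc n x - trunc m x).
Proof.
apply: (@int_ind_up (fun n => m <= n -> pZ m (trunc n x - trunc m x)) m) n => [n h1 h2|n ih h].
  by have -> : n = m; [lia|rewrite subrr pZ_0].
have [->|?] := eqVneq m (n + 1); first by rewrite subrr pZ_0.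
rewrite truncS addrAC; apply: pZ_D; [apply: ih|apply: pZ_int]; lia.
Qed.

Lemma close_trunc n x y : Qp_close n x y <-> trunc n x = trunc n y.
Proof.
split.
  apply: (@int_ind_up (fun n => Qp_close n x y -> trunc n x = trunc n y)
    (Num.min (lowb x) (lowb y))) n => [n|n ih h].
    by rewrite le_min => /andP[? ?] _; rewrite !trunc_low.
  rewrite !truncS ih ?h // => [|k kn]; [lia|apply: h; lia].
move=> h k kn.
(* Truncation at [m] is the residue modulo p^m of truncation at [n], so equality descends; comparing
   the levels [k] and [k + 1] then isolates the digit [k]. *)
have tE m : m <= n -> trunc m x = trunc m y.
  move=> mn; apply: (@pZ_uniq m); rewrite ?trunc_itv //.
  have -> : trunc m x - trunc m y =
    (trunc n y - trunc m y) - (trunc n x - trunc m x) by rewrite h; ring.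
  by apply: pZ_B; exact: trunc_cong.
have := tE (k + 1); rewrite !truncS tE; last lia.
have pk := exprz_gt0 k pQ_gt0.
move=> /(_ _)/addrI/(mulIf (lt0r_neq0 pk))/eqP; rewrite eqr_nat => /(_ _)/eqP.
by apply; lia.
Qed.

Lemma close_cong n x y : Qp_close n x y <-> pZ n (trunc n x - trunc n y).
Proof.
rewrite close_trunc; split=> [->|h]; first by rewrite subrr pZ_0.
by apply: (pZ_uniq h); rewrite trunc_itv.
Qed.

(** Sum, opposite and product all read digit [k] off a rational that is right only modulo p^(k+1).
    Coherence of these approximations makes the digits fit together, so that carries never have to
    be followed. *)
Lemma trunc_Qp_of (q : int -> rat) :
  (forall n, pZ n (q (n + 1) - q n)) -> (exists m, forall n, n <= m -> pZ n (q n)) ->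
  forall n, trunc n (Qp_of p (fun k => digit_of p (q (k + 1)) k)) = prem n (q n).
Proof.
move=> qS [m qm].
have dlow k : k < m -> digit_of p (q (k + 1)) k = 0%N.
  move=> km; have h1 : pZ (k + 1) (q (k + 1)) by apply: qm; lia.
  have := premS k (q (k + 1)); rewrite !prem_eq0 //; last first.
    by apply: (@pZ_le (k + 1)) => //; lia.
  rewrite add0r => /esym/eqP; rewrite mulf_eq0 (gt_eqF (exprz_gt0 _ _)) // orbF.
  by rewrite pnatr_eq0 => /eqP.
have valid : is_padic p (fun k => digit_of p (q (k + 1)) k).
  by split=> [k|]; [exact: digit_of_le|exists m].
set x := Qp_of _ _.
have dx k : digit x k = digit_of p (q (k + 1)) k.
  by rewrite /x /Qp_of; case: pselect.
apply: (@int_ind_up (fun n => trunc n x = prem n (q n)) (Num.min m (lowb x))) => [n|n ih].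
  by rewrite le_min => /andP[? ?]; rewrite trunc_low // prem_eq0 // qm.
by rewrite truncS ih dx premS; congr (_ + _); apply/esym/prem_eq.
Qed.

Lemma trunc_add n x y : pZ n (trunc n (Qp_add x y) - (trunc n x + trunc n y)).
Proof.
rewrite /Qp_add (@trunc_Qp_of (fun n => trunc n x + trunc n y)).
- exact: prem_pZ.
- move=> k; have -> : trunc (k + 1) x + trunc (k + 1) y - (trunc k x + trunc k y)
    = (trunc (k + 1) x - trunc k x) + (trunc (k + 1) y - trunc k y) by ring.
  by apply: pZ_D; apply: trunc_cong; lia.
- exists (Num.min (lowb x) (lowb y)) => k; rewrite le_min => /andP[? ?].
  by rewrite !trunc_low // addr0 pZ_0.
Qed.

Lemma trunc_opp n x : pZ n (trunc n (Qp_opp x) + trunc n x).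
Proof.
rewrite /Qp_opp (@trunc_Qp_of (fun n => p%:Q ^ n - trunc n x)).
- have -> (u v : rat) : u + v = (u - (p%:Q ^ n - v)) + p%:Q ^ n by ring.
  by apply: pZ_D; [exact: prem_pZ|exact: pZ_exp].
- move=> k; have -> : p%:Q ^ (k + 1) - trunc (k + 1) x - (p%:Q ^ k - trunc k x)
    = (p%:Q ^ (k + 1) - p%:Q ^ k) - (trunc (k + 1) x - trunc k x) by ring.
  by apply: pZ_B; [apply: pZ_B; apply: pZ_exp|apply: trunc_cong]; lia.
- exists (lowb x) => k ?; rewrite trunc_low // subr0; exact: pZ_exp.
Qed.

Lemma trunc_sub n x y : pZ n (trunc n (Qp_sub x y) - (trunc n x - trunc n y)).
Proof.
have -> : trunc n (Qp_sub x y) - (trunc n x - trunc n y) =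
  (trunc n (Qp_add x (Qp_opp y)) - (trunc n x + trunc n (Qp_opp y))) +
  (trunc n (Qp_opp y) + trunc n y) by rewrite /Qp_sub; ring.
by apply: pZ_D; [exact: trunc_add|exact: trunc_opp].
Qed.

Lemma trunc0 n : trunc n (Qp0 p) = 0.
Proof. by rewrite /trunc big1 // => i _; rewrite mul0r. Qed.

Lemma pZ_eq n q r : pZ n (q - r) -> pZ n q = pZ n r.
Proof.
move=> h; apply/idP/idP => h'.
  have -> : r = q - (q - r) by ring.
  exact: pZ_B.
by rewrite -(subrK r q); apply: pZ_D.
Qed.

Lemma close_sub n x y : Qp_close n (Qp_sub x y) (Qp0 p) <-> Qp_close n x y.
Proof. by rewrite !close_cong trunc0 subr0 (pZ_eq (trunc_sub n x y)). Qed.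

Lemma pZ_eqB n q q' r r' : pZ n (q - q') -> pZ n (r - r') ->
  pZ n (q - r) = pZ n (q' - r').
Proof.
move=> hq hr; apply: pZ_eq.
have -> : q - r - (q' - r') = (q - q') - (r - r') by ring.
exact: pZ_B.
Qed.

Lemma pZ_refl n q : pZ n (q - q). Proof. by rewrite subrr pZ_0. Qed.

Lemma close_addr n x y z : Qp_close n (Qp_add x z) (Qp_add y z) <-> Qp_close n x y.
Proof.
rewrite !close_cong (pZ_eqB (trunc_add n x z) (trunc_add n y z)).
by rewrite opprD addrACA subrr addr0.
Qed.

Lemma close_add_sub n x y z : Qp_close n (Qp_add x z) y <-> Qp_close n x (Qp_sub y z).
Proof.
rewrite !close_cong (pZ_eqB (trunc_add n x z) (pZ_refl n (trunc n y))).
rewrite (pZ_eqB (pZ_refl n (trunc n x)) (trunc_sub n y z)).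
by rewrite opprB addrA addrAC.
Qed.

Lemma close_addK n x z : Qp_close n (Qp_sub (Qp_add x z) z) x.
Proof.
rewrite close_cong (pZ_eqB (trunc_sub n _ z) (pZ_refl n (trunc n x))).
by rewrite -addrA -opprD [trunc n z + _]addrC; exact: trunc_add.
Qed.

(** Extending [x] beyond index [K] adds a multiple of p^K, and every truncation of [y] is a multiple
    of p^(m-K), so the product changes by a multiple of p^m; likewise with the factors exchanged. *)
Lemma trunc_mul_cong m x y (K K' L L' : int) :
  (forall k, k < m - K -> digit y k = 0%N) ->
  (forall k, k < m - L -> digit x k = 0%N) -> K <= K' -> L <= L' ->
  pZ m (trunc K' x * trunc L' y - trunc K x * trunc L y).
Proof.
move=> hy hx KK' LL'.
have -> : trunc K' x * trunc L' y - trunc K x * trunc L y =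
  (trunc K' x - trunc K x) * trunc L' y + trunc K x * (trunc L' y - trunc L y).
  by ring.
apply: pZ_D.
  have -> : m = K + (m - K) by lia.
  by apply: pZ_M; [exact: trunc_cong|exact: trunc_pZ].
have -> : m = (m - L) + L by lia.
by apply: pZ_M; [exact: trunc_pZ|exact: trunc_cong].
Qed.

Lemma trunc_mul x y (m K L : int) :
  (forall k, k < m - K -> digit y k = 0%N) ->
  (forall k, k < m - L -> digit x k = 0%N) ->
  pZ m (trunc m (Qp_mul x y) - trunc K x * trunc L y).
Proof.
move=> hy hx.
(* The precision that [Qp_mul] uses for digit [n - 1]. It is compared with [K] and [L] through the
   maximum of both precisions. *)
pose N (n : int) : int := (absz (n - 1))%:Z + 1 - lowb x - lowb y.
have hN m' K' L' : (forall k, k < m' - K' -> digit y k = 0%N) ->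
    (forall k, k < m' - L' -> digit x k = 0%N) ->
    forall n, m' <= n <= m' + 1 ->
    pZ m' (trunc (N n) x * trunc (N n) y - trunc K' x * trunc L' y).
  move=> hy' hx' n hn; have := lowb_le0 x; have := lowb_le0 y => y0 x0.
  have -> : trunc (N n) x * trunc (N n) y - trunc K' x * trunc L' y =
    (trunc (Num.max K' (N n)) x * trunc (Num.max L' (N n)) y -
       trunc K' x * trunc L' y) -
    (trunc (Num.max K' (N n)) x * trunc (Num.max L' (N n)) y -
       trunc (N n) x * trunc (N n) y) by ring.
  apply: pZ_B; apply: trunc_mul_cong; rewrite ?le_max ?lexx ?orbT //.
  - by move=> k hk; apply: digit_lowb; move: hk hn; rewrite /N; lia.
  - by move=> k hk; apply: digit_lowb; move: hk hn; rewrite /N; lia.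
have hNN m' : (forall k, k < m' - N m' -> digit y k = 0%N) /\
    (forall k, k < m' - N m' -> digit x k = 0%N).
  have := lowb_le0 x; have := lowb_le0 y => y0 x0.
  by split=> k hk; apply: digit_lowb; move: hk; rewrite /N; lia.
have -> : trunc m (Qp_mul x y) = prem m (trunc (N m) x * trunc (N m) y).
  rewrite -(@trunc_Qp_of (fun n => trunc (N n) x * trunc (N n) y)).
  - rewrite /Qp_mul; congr (trunc m (Qp_of p _)); apply/funext => k.
    by rewrite /N addrK.
  - by move=> n; have [h1 h2] := hNN n; apply: hN => //; lia.
  - exists (lowb x + lowb y) => n hn; apply: (pZ_le hn); apply: pZ_M;
      apply: trunc_pZ => k; exact: digit_lowb.
rewrite (pZ_eqB (prem_pZ m _) (pZ_refl m _)).
by apply: hN => //; lia.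
Qed.

End PadicArithmetic.

(** * The p-adic valuation as index of the first nonzero digit *)

Section Valuation.
Variable p : nat.
Implicit Types (x : Qp p) (n v k : int).

Definition isval x v := digit x v <> 0%N /\ forall j, j < v -> digit x j = 0%N.

Lemma isval_close x v n : isval x v -> (Qp_close n x (Qp0 p) <-> n <= v).
Proof.
move=> [h1 h2]; split=> h; first by rewrite leNgt; apply/negP => /h.
by move=> j jn; apply: h2; lia.
Qed.

Lemma Qp_valP x : (forall n, Qp_close n x (Qp0 p)) \/ exists v, isval x v.
Proof.
have [h|/existsNP[k hk]] := pselect (forall k, digit x k = 0%N).
  by left=> n k _; exact: h.
right; have kl : lowb x <= k by rewrite leNgt; apply/negP => /digit_lowb.
pose Q (i : nat) := digit x (lowb x + i%:Z) != 0%N.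
have exQ : exists i, Q i.
  exists (absz (k - lowb x)); apply/eqP; rewrite (_ : _ + _ = k) //; lia.
case: (ex_minnP exQ) => i /eqP hi hmin; exists (lowb x + i%:Z); split=> // j ji.
have [/digit_lowb //|lj] := ltP j (lowb x).
apply/eqP; apply: contraT => hj; have := hmin (absz (j - lowb x)).
rewrite /Q (_ : lowb x + _ = j); last lia.
by move=> /(_ hj); lia.
Qed.

Lemma closeS n x (y : Qp p) : Qp_close (n + 1) x y <-> Qp_close n x y /\ digit x n = digit y n.
Proof.
split=> [h|[h1 h2] k kn].
  by split=> [k kn|]; apply: h; lia.
have [->//|kn'] := eqVneq k n; apply: h1; lia.
Qed.

End Valuation.

(** * Balls as intervals of reals *)

Section RealDigits.
Variables (p : nat) (R : realType).
Hypothesis p1 : (1 < p)%N.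
Let p0 : (0 < p)%N := ltnW p1.
Let pR_gt0 : 0 < (p%:R : R). Proof. by rewrite ltr0n. Qed.
Let pR_neq0 : (p%:R : R) != 0. Proof. by rewrite gt_eqF. Qed.
Let pR_gt1 : 1 < (p%:R : R). Proof. by rewrite ltr1n. Qed.
Let pX_gt0 (n : int) : 0 < (p%:R : R) ^ n. Proof. exact: exprz_gt0. Qed.
Implicit Types (x z : Qp p) (m n k v : int) (u : R).

Lemma Qp_abs_val x v : isval x v -> Qp_abs R x = p%:R ^ (- v).
Proof.
move=> hv; rewrite /Qp_abs; case: pselect => [H|]; last by case; exists v.
case: cid => w /= hw; congr (_ ^ (- _)).
have /(isval_close _ hw) : Qp_close v x (Qp0 p) by apply/(isval_close _ hv).
have /(isval_close _ hv) : Qp_close w x (Qp0 p) by apply/(isval_close _ hw).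
by lia.
Qed.

Lemma Qp_abs_zero x : (forall n, Qp_close n x (Qp0 p)) -> Qp_abs R x = 0.
Proof.
move=> h; rewrite /Qp_abs; case: pselect => // H; exfalso; case: H => v [hv _].
by apply: hv; apply: (h (v + 1)); lia.
Qed.

Lemma Qp_abs_ge0 x : 0 <= Qp_abs R x.
Proof.
have [h|[v h]] := Qp_valP x; first by rewrite Qp_abs_zero.
by rewrite (Qp_abs_val h) ltW.
Qed.

Lemma Qp_abs_le x k : Qp_abs R x <= p%:R ^ k <-> Qp_close (- k) x (Qp0 p).
Proof.
have [h|[v hv]] := Qp_valP x; first by rewrite Qp_abs_zero // ltW.
rewrite (Qp_abs_val hv) ler_eXz2l // (isval_close _ hv); lia.
Qed.

Lemma Qp_ballE k x : Qp_ball R k x = [set w | Qp_close (- k) w x].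
Proof.
by apply/seteqP; split=> w; rewrite /Qp_ball /= Qp_abs_le close_sub.
Qed.

Local Notation xi := (@Qp_of_real p R).
Local Notation fl n u := (Num.floor (u * (p%:R : R) ^ n)).

Lemma flS n u : fl (n + 1) u = p%:Z * fl n u + (fl (n + 1) u %% p%:Z)%Z.
Proof.
have h : u * (p%:R : R) ^ (n + 1) = (u * p%:R ^ n) * p%:R.
  by rewrite expfzDr // expr1z mulrA.
rewrite {1}(divz_eq (fl (n + 1) u) p%:Z); congr (_ + _).
by rewrite h floorM_nat // mulrC.
Qed.

Lemma fl_low u : 0 <= u -> exists m, forall n, n <= m -> fl n u = 0.
Proof.
move=> u0; have uN := upper_nthrootP (leqnn (Num.Def.archi_bound u)).
set N := Num.Def.archi_bound u in uN.
exists (- N%:Z) => n nN; apply/floor_def; rewrite add0r mulr_ge0 ?(ltW (pX_gt0 _)) //=.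
have uN' : u < p%:R ^ N%:Z.
  by apply: lt_le_trans uN _; rewrite lerXn2r ?nnegrE ?ler_nat.
have : u * p%:R ^ n < p%:R ^ N%:Z * p%:R ^ n by rewrite ltr_pM2r.
move=> /lt_le_trans; apply; rewrite -expfzDr // -(expr0z (p%:R : R)).
by rewrite ler_eXz2l //; lia.
Qed.

Lemma digit_Qp_of_real u k : 0 <= u ->
  (digit (xi u) k)%:Z = (fl (k + 1) u %% p%:Z)%Z.
Proof.
move=> u0; have [m hm] := fl_low u0.
pose d := fun k => absz (fl (k + 1) u %% p%:Z)%Z.
have hd : is_padic p d.
  split=> [j|]; rewrite /d.
    have := @ltz_pmod (fl (j + 1) u) p%:Z; have := modz_absz (fl (j + 1) u) p0.
    by lia.
  by exists m => j jm; rewrite hm ?mod0z //; lia.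
rewrite -modz_absz // /Qp_of_real /Qp_of; case: pselect => [h|]; first by [].
by case.
Qed.

Lemma fl_digit n u : 0 <= u -> fl (n + 1) u = p%:Z * fl n u + (digit (xi u) n)%:Z.
Proof. by move=> u0; rewrite digit_Qp_of_real // -flS. Qed.

Lemma fl_digit_eq n u (N : int) (c : nat) : (c <= p.-1)%N -> 0 <= u ->
  fl (n + 1) u = p%:Z * N + c%:Z <-> fl n u = N /\ digit (xi u) n = c.
Proof.
move=> cp u0; rewrite fl_digit //; split=> [h|[-> ->]] //.
have dp := digit_le (p := p) (xi u) n.
have hN : fl n u = N by nia.
by split=> //; move: h; rewrite hN; lia.
Qed.

Lemma close0_fl n u : 0 <= u -> (Qp_close n (xi u) (Qp0 p) <-> fl n u = 0).
Proof.
move=> u0; have [m hm] := fl_low u0.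
apply: (@int_ind_up (fun n => Qp_close n (xi u) (Qp0 p) <-> fl n u = 0) m) n
  => [n nm|n ih].
  split=> [_|_ k kn]; first exact: hm.
  have := digit_Qp_of_real k u0; rewrite hm ?mod0z; last lia.
  by rewrite /digit /=; case.
have := @fl_digit_eq n u 0 0 isT u0; rewrite mulr0 addr0 => ->.
by rewrite closeS ih.
Qed.

(** The digits of [xi u] below index [n] are the base-[p] digits of the integer [fl n u] in reverse
    order, so fixing them amounts to fixing this integer. This is why balls become real
    intervals. *)
Lemma close_fl z n : exists2 N : int, 0 <= N &
  forall u, 0 <= u -> (Qp_close n (xi u) z <-> fl n u = N).
Proof.
apply: (@int_ind_up (fun n => exists2 N : int, 0 <= N &
  forall u, 0 <= u -> (Qp_close n (xi u) z <-> fl n u = N)) (lowb z)) n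
  => [n nm|n [N N0 ih]].
  exists 0 => // u u0; rewrite -close0_fl //.
  by split=> h k kn; rewrite h // (digit_lowb (x := z)) //; lia.
exists (p%:Z * N + (digit z n)%:Z) => [|u u0]; first by lia.
by rewrite closeS ih // fl_digit_eq // digit_le.
Qed.

Definition digit_cell n (N : int) : set R :=
  [set` `[N%:~R * (p%:R : R) ^ (- n), (N + 1)%:~R * (p%:R : R) ^ (- n)[%R].

Local Notation cell := digit_cell.

Lemma in_cell n N u : cell n N u <-> fl n u = N.
Proof.
rewrite /digit_cell /= in_itv /=.
have pE : u = (u * p%:R ^ n) * p%:R ^ (- n) by rewrite -mulrA -expfzDr // subrr mulr1.
rewrite {1 2}pE ler_pM2r // ltr_pM2r // -floor_eq; split=> [/eqP//|->//].
Qed.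

Lemma cell_ge0 n N u : 0 <= N -> cell n N u -> 0 <= u.
Proof.
move=> N0; rewrite /digit_cell /= in_itv /= => /andP[h _]; apply: le_trans h.
by rewrite mulr_ge0 ?ler0z // ltW.
Qed.

Lemma cell_ball z n : exists2 N : int, 0 <= N &
  [set u | 0 <= u /\ Qp_close n (xi u) z] = cell n N.
Proof.
have [N N0 h] := close_fl z n; exists N => //; apply/seteqP; split=> u /=.
  by move=> [u0 /(h _ u0)]; rewrite in_cell.
by move=> hu; have u0 := cell_ge0 N0 hu; split=> //; apply/(h _ u0)/in_cell.
Qed.

Lemma cell_origin n u : 0 <= u -> (Qp_close n (xi u) (Qp0 p) <-> u < p%:R ^ (- n)).
Proof.
move=> u0; rewrite close0_fl // -in_cell /cell /= in_itv /= mul0r u0 /=.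
by rewrite add0r mul1r.
Qed.

Lemma measurable_cell n N : measurable (cell n N).
Proof. exact: measurable_itv. Qed.

Lemma measure_cell n N : lebesgue_measure (cell n N) = ((p%:R : R) ^ (- n))%:E.
Proof.
rewrite /digit_cell lebesgue_measure_itv /= lte_fin ltr_pM2r // ltr_int ltzD1 lexx.
by rewrite -EFinB -mulrBl -intrB addrAC subrr add0r mul1r.
Qed.

Lemma isval_xi u k : (p%:R : R) ^ (k - 1) <= u < p%:R ^ k -> isval (xi u) (- k).
Proof.
move=> /andP[h1 h2]; have u0 : 0 <= u by apply: le_trans h1; exact: ltW.
have c1 : Qp_close (- k) (xi u) (Qp0 p) by apply/cell_origin; rewrite ?opprK.
have c2 : ~ Qp_close (- k + 1) (xi u) (Qp0 p).
  by rewrite cell_origin // opprD opprK ltNge h1.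
by split=> // h; apply: c2; apply/closeS; split=> //; rewrite h.
Qed.

Lemma measurable_fun_const_pieces (D : set R) (F : (set R)^nat) d2
    (T2 : measurableType d2) (f : R -> T2) :
  (forall i, measurable (F i)) -> D = \bigcup_i F i ->
  (forall i u u', F i u -> F i u' -> f u = f u') -> measurable_fun D f.
Proof.
move=> mF -> hf; apply/measurable_fun_bigcup => // i.
have [->|/set0P[u Fu]] := eqVneq (F i) set0; first exact: measurable_fun_set0.
apply: (@eq_measurable_fun _ _ _ _ _ (cst (f u))); last exact: measurable_cst.
by move=> u' /set_mem Fu'; exact: hf Fu Fu'.
Qed.

Definition radial (T : Type) z (f : Qp p -> T) :=
  forall x x', (forall n, Qp_close n x z <-> Qp_close n x' z) -> f x = f x'.

(** The spheres around [z], together with the point [z], are countably many measurable pieces on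
    each of which [f] is constant. *)
Lemma measurable_radial d2 (T2 : measurableType d2) z (f : Qp p -> T2) :
  radial z f -> measurable_fun (`[0, +oo[ : set R) (f \o xi).
Proof.
move=> fr.
pose C n := [set u : R | 0 <= u /\ Qp_close n (xi u) z].
have mC n : measurable (C n).
  by have [N _ hN] := cell_ball z n; rewrite /C hN; exact: measurable_cell.
(* Spheres are indexed by integers coded as naturals. Piece 0 is the centre; naturals that code
   nothing repeat the sphere of index 0. *)
pose ix (i : nat) : int := odflt 0 (unpickle i).
pose F (i : nat) := if i is j.+1 then C (ix j) `\` C (ix j + 1)
  else \bigcap_(n : nat) C n%:Z.
have CS n n' u : n <= n' -> C n' u -> C n u.
  by move=> nn' [u0 h]; split=> // k kn; apply: h; lia.
apply: (@measurable_fun_const_pieces _ F) => //.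
- move=> [|i]; first by apply: bigcap_measurable.
  exact: measurableD.
- apply/seteqP; split=> u; last first.
    move=> [[|i] _ /= hu]; rewrite in_itv /= andbT; last by have [[]] := hu.
    by have [] := hu 0%N I.
  rewrite /= in_itv /= andbT => u0.
  have [h|/existsNP[n hn]] := pselect (forall n : nat, C n%:Z u).
    by exists 0%N => // n _; exact: h.
  have [m hm] : exists m : int, C m u.
    have [m hm] := fl_low u0; exists (Num.min m (lowb z)); split=> // k.
    rewrite lt_min => /andP[km kl]; rewrite (digit_lowb kl).
    have /close0_fl : fl m u = 0 by exact: hm.
    by move=> /(_ u0) ->.
  have : exists v, C v u /\ ~ C (v + 1) u.
    apply: contrapT => /forallNP hv; apply: hn.
    apply: (@int_ind_up (fun n => C n u) m) => [k km|k Ck]; first exact: CS hm.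
    by apply: contrapT => nk; exact: (hv k).
  move=> [v hv]; exists (pickle v).+1 => //=; rewrite /ix pickleK; exact: hv.
- move=> [|i] u u' /= hu hu'; apply: fr => n.
    have all (w : R) : (\bigcap_(n : nat) C n%:Z) w -> Qp_close n (xi w) z.
      move=> /(_ (absz n) I) [_ h] k kn; apply: h; lia.
    by split=> _; exact: all.
  have all w w' : (C (ix i) `\` C (ix i + 1)) w -> (C (ix i) `\` C (ix i + 1)) w' ->
      Qp_close n (xi w) z -> Qp_close n (xi w') z.
    move=> [[w0 h1] h2] [[w0' h1'] h2'] hn k kn; apply: h1'.
    have : n <= ix i.
      rewrite leNgt; apply/negP => hlt; apply: h2; apply: (CS _ n); first lia.
      by split.
    by lia.
  by split; exact: all.
Qed.

End RealDigits.

Local Opaque Qp_add Qp_sub Qp_opp Qp_mul Qp_abs Qp_of_real Qp_ball.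

(** * Cancellation of the additive character *)

Section Character.
Variables (p : nat) (R : realType).
Hypothesis p1 : (1 < p)%N.
Let p0 : (0 < p)%N := ltnW p1.
Let pR_gt0 : 0 < (p%:R : R). Proof. by rewrite ltr0n. Qed.
Let pR_neq0 : (p%:R : R) != 0. Proof. by rewrite gt_eqF. Qed.
Let pX_gt0 (n : int) : 0 < (p%:R : R) ^ n. Proof. exact: exprz_gt0. Qed.
Local Notation xi := (@Qp_of_real p R).
Local Notation fl n u := (Num.floor (u * (p%:R : R) ^ n)).
Local Notation leb := (@lebesgue_measure R).
Local Notation cell := (@digit_cell p R).

(** The real part of a full geometric sum of powers of exp(2 pi i c / p). Multiplying by 2 sin(alpha
    / 2), nonzero since 0 < alpha / 2 < pi, makes it telescope to a difference over [c] full
    periods. *)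
Lemma sum_cos_eq0 (theta : R) (c : nat) : (0 < c < p)%N ->
  \sum_(d < p) cos (theta + d%:R * (2 * pi * c%:R / p%:R)) = 0.
Proof.
move=> /andP[c0 cp]; set alpha := 2 * pi * c%:R / p%:R.
have pi0 := pi_gt0 R.
have sn0 : 2 * sin (alpha / 2) != 0.
  rewrite mulf_neq0 // gt_eqF // sin_gt0_pi //.
  have -> : alpha / 2 = pi * (c%:R / p%:R) by rewrite /alpha; field.
  rewrite mulr_gt0 ?divr_gt0 ?ltr0n //= -[X in _ < X]mulr1 ltr_pM2l //.
  by rewrite ltr_pdivrMr // mul1r ltr_nat.
apply: (mulfI sn0); rewrite mulr0 big_distrr /=.
pose f (d : nat) := sin (theta + d%:R * alpha - alpha / 2).
under eq_bigr => d _.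
  rewrite (_ : _ * _ * cos _ = f d.+1 - f d); last first.
    rewrite /f -[d.+1%:R]natr1.
    have -> : theta + (d%:R + 1) * alpha - alpha / 2 =
      (theta + d%:R * alpha) + alpha / 2 by field.
    by rewrite sinD sinB; ring.
  over.
rewrite -(big_mkord predT (fun d => f d.+1 - f d)) telescope_sumr // /f.
have -> : theta + p%:R * alpha - alpha / 2 =
    (theta + 0%:R * alpha - alpha / 2) + (pi *+ 2) *+ c.
  by rewrite /alpha -mulr_natr -[pi *+ 2]mulr_natr; field.
by rewrite (periodicn (@sinD2pi R)) subrr.
Qed.

Lemma cos_mod1 (q r : rat) : q - r \is a Num.int ->
  cos (2 * pi * ratr q) = cos (2 * pi * ratr r) :> R.
Proof.
move=> /intrP[z qr]; have -> : q = r + z%:~R by rewrite -qr addrC subrK.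
rewrite rmorphD rmorph_int /= mulrDr; case: z {qr} => n.
  rewrite (_ : 2 * pi * (Posz n)%:~R = (pi *+ 2) *+ n).
    exact: (periodicn (@cosD2pi R)).
  by rewrite -mulr_natr -[pi *+ 2]mulr_natr pmulrn; ring.
rewrite NegzE -(periodicn (@cosD2pi R) n.+1) -addrA.
rewrite (_ : _ + _ *+ _ *+ _ = 0) ?addr0 //.
by rewrite -mulr_natr -[pi *+ 2]mulr_natr mulrNz -pmulrn; ring.
Qed.

Lemma chi_re_congr (x y : Qp p) (q : rat) : pZ p 0 (trunc 0 (Qp_mul x y) - q) ->
  chi_re R (Qp_mul x y) = cos (2 * pi * ratr q).
Proof. by rewrite /pZ oppr0 expr0z mulr1 => /cos_mod1. Qed.

Lemma chi_re1 (x y : Qp p) (K : int) :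
  Qp_close K x (Qp0 p) -> Qp_close (- K) y (Qp0 p) ->
  chi_re R (Qp_mul x y) = 1.
Proof.
move=> hx hy.
have h : pZ p 0 (trunc 0 (Qp_mul x y) - trunc K x * trunc (- K) y).
  apply: trunc_mul => // k; rewrite sub0r ?opprK; [exact: hy|exact: hx].
rewrite (chi_re_congr h) (iffLR (close_trunc p1 K x (Qp0 p))) // trunc0 mul0r rmorph0.
by rewrite mulr0 cos0.
Qed.

(* On a cell of level [- v - 1] the phase depends only on the next digit, which
   moves it in steps of [2 pi c / p], with [c] the leading digit of [x]. *)
Lemma chi_re_cell (x : Qp p) (v M : int) : isval x v -> 0 <= M ->
  exists theta : R, forall u, cell (- v - 1) M u ->
    chi_re R (Qp_mul x (xi u)) =
    cos (theta + (digit (xi u) (- v - 1))%:R * (2 * pi * (digit x v)%:R / p%:R)).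
Proof.
move=> [_ hx] M0; pose u0 : R := M%:~R * p%:R ^ (v + 1).
have u00 : 0 <= u0 by rewrite mulr_ge0 ?ler0z ?(ltW (pX_gt0 _)).
have fu0 : fl (- v - 1) u0 = M.
  rewrite /u0 -mulrA -expfzDr // (_ : v + 1 + (- v - 1) = 0); last by lia.
  by rewrite expr0z mulr1 intrKfloor.
(* No digit of [xi u] lies below [L], so the digits of [x] below [- L] determine the fractional part
   of the product. *)
pose L := Num.min (lowb (xi u0)) (- v - 1).
exists (2 * pi * ratr (trunc (- L) x * trunc (- v - 1) (xi u0))) => u uM.
have uge0 := cell_ge0 p1 M0 uM; move/in_cell : uM => /(_ p1) fu.
have cu : Qp_close (- v - 1) (xi u) (xi u0).
  have [N _ hN] := close_fl R p1 (xi u0) (- v - 1).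
  by apply/hN => //; rewrite fu -fu0; apply/hN.
set d := digit (xi u) (- v - 1).
have h : pZ p 0 (trunc 0 (Qp_mul x (xi u)) - trunc (- L) x * trunc (- v) (xi u)).
  apply: trunc_mul => // k; rewrite sub0r opprK; last exact: hx.
  by rewrite lt_min => /andP[k1 k2]; rewrite cu // digit_lowb.
rewrite (chi_re_congr (q := trunc (- L) x * trunc (- v - 1) (xi u0) +
   d%:R * (digit x v)%:R / p%:R)); last first.
  rewrite -(pZ_eq (q := trunc 0 (Qp_mul x (xi u)) - trunc (- L) x * trunc (- v) (xi u))) //.
  have hv : trunc (- v) (xi u) = trunc (- v - 1) (xi u0) + d%:R * p%:Q ^ (- v - 1).
    by rewrite -(iffLR (close_trunc p1 _ _ _) cu) -truncS // subrK.
  have xv : trunc (v + 1) x = (digit x v)%:R * p%:Q ^ v.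
    by rewrite truncS // (iffLR (close_trunc p1 v x (Qp0 p))) // trunc0 add0r.
  (* Against the digit of index [- v - 1], all of [x] beyond its leading term contributes an
     integer. *)
  have hX : pZ p (v + 1) (trunc (- L) x - (digit x v)%:R * p%:Q ^ v).
    by rewrite -xv; apply: trunc_cong => //; rewrite /L; lia.
  have := pZ_M p1 hX (pZ_int (p := p) p1 d (lexx (- v - 1))).
  rewrite (_ : v + 1 + (- v - 1) = 0); last by lia.
  rewrite -(pZ_N p 0); congr (is_true (pZ p 0 _)); rewrite hv.
  have -> : p%:Q ^ (- v - 1) = (p%:Q ^ v)^-1 * p%:Q^-1.
    by rewrite expfzDr ?pnatr_eq0 -?lt0n // invr_expz.
  have hp : p%:Q ^ v != 0 by rewrite expfz_neq0 // pnatr_eq0 -lt0n.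
  have hq : p%:R != 0 :> rat by rewrite pnatr_eq0 -lt0n.
  have E (A B C D q c e : rat) : D != 0 -> q != 0 ->
      - ((C - c * D) * (e * (D^-1 / q))) =
      B - C * (A + e * (D^-1 / q)) - (B - (C * A + e * c / q)).
    by move=> ? ?; field; apply/andP.
  by rewrite -pmulrn; apply: E.
congr cos; rewrite rmorphD mulrDr; congr (_ + _).
by rewrite fmorph_div rmorphM !rmorph_nat; field.
Qed.

Lemma cell_split (v M : int) (d : nat) u : (d < p)%N -> 0 <= M ->
  cell (- v) (p%:Z * M + d%:Z) u ->
  cell (- v - 1) M u /\ digit (xi u) (- v - 1) = d.
Proof.
move=> dp M0 hu; have u0 : 0 <= u by apply: cell_ge0 hu => //; lia.
move/in_cell : hu => /(_ p1) hu.
have := @fl_digit_eq p R p1 (- v - 1) u M d; rewrite subrK => h.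
by have [h1 h2] := (h ltac:(lia) u0).1 hu; split=> //; apply/in_cell.
Qed.

Lemma measurable_chi_re (x : Qp p) :
  measurable_fun (`[0, +oo[ : set R) (fun u => chi_re R (Qp_mul x (xi u))).
Proof.
have [hx|[v hv]] := Qp_valP x.
  apply: (@eq_measurable_fun _ _ _ _ _ (cst (1 : R))); last exact: measurable_cst.
  move=> u _; rewrite (chi_re1 (K := - lowb (xi u))) // opprK => k.
  by move=> /digit_lowb ->.
(* One level finer than in [chi_re_cell] the next digit is fixed too, so the character is constant
   on each cell. *)
apply: (@measurable_fun_const_pieces R _ (fun i : nat => cell (- v) i%:Z)).
- by move=> i; exact: measurable_cell.
- apply/seteqP; split=> u /=; rewrite in_itv /= andbT.
    move=> u0; exists (absz (fl (- v) u)) => //; apply/in_cell => //.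
    by rewrite gez0_abs // floor_ge0 mulr_ge0 // ltW.
  by move=> [i _]; exact: cell_ge0.
- move=> i u u' hu hu'; have M0 : 0 <= (i %/ p)%N%:Z by [].
  have [theta ht] := chi_re_cell hv M0.
  have iE : i%:Z = p%:Z * (i %/ p)%N%:Z + (i %% p)%N%:Z.
    by rewrite {1}(divn_eq i p) PoszD PoszM mulrC.
  rewrite iE in hu hu'.
  have [h1 h2] := cell_split (ltn_pmod i p0) M0 hu.
  have [h1' h2'] := cell_split (ltn_pmod i p0) M0 hu'.
  apply: (etrans (ht _ h1)); rewrite h2 -h2'; exact/esym/ht.
Qed.

Lemma integral_stairs (f : R -> R) (a h : R) (n : nat) (c : nat -> R) : 0 <= h ->
  measurable_fun `[a, a + n%:R * h[ f ->
  (forall d u, (d < n)%N -> a + d%:R * h <= u < a + d.+1%:R * h -> f u = c d) ->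
  (\int[leb]_(u in `[a, (a + n%:R * h)%R[) (f u)%:E =
   (h * \sum_(d < n) c d)%:E)%E.
Proof.
move=> h0; elim: n => [|n ih] mf hc.
  by rewrite mul0r addr0 set_itvE integral_set0 big_ord0 mulr0.
have nh : a + n%:R * h <= a + n.+1%:R * h.
  by rewrite lerD2l ler_wpM2r // ler_nat.
have anh : a <= a + n%:R * h by rewrite lerDl mulr_ge0.
have E : `[a, a + n.+1%:R * h[%classic =
    `[a, a + n%:R * h[ `|` `[a + n%:R * h, a + n.+1%:R * h[ :> set R.
  apply/seteqP; split=> u /=; rewrite !in_itv /=.
    by move=> /andP[-> ->]; rewrite andbT /=; apply/orP; case: ltP.
  move=> [|] /andP[h1 h2]; first by rewrite h1 (lt_le_trans h2).
  by rewrite h2 (le_trans anh).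
rewrite E integral_setU //=; first last.
- rewrite disj_set2E; apply/eqP/seteqP; split=> u //=; rewrite !in_itv /=.
  by move=> [/andP[_ h1] /andP[h2 _]]; move: h1; rewrite ltNge h2.
- by rewrite -E; apply/measurable_EFinP.
rewrite ih; last 2 first.
- by apply: measurable_funS mf => //; rewrite E; exact: subsetUl.
- by move=> d u dn; apply: hc; exact: ltnW.
rewrite (eq_integral (cst (c n)%:E)); last first.
  by move=> u /set_mem /=; rewrite in_itv /= => /hc ->.
rewrite integral_cst //= lebesgue_measure_itv /= lte_fin big_ord_recr /= mulrDr.
have -> : a + n.+1%:R * h = a + n%:R * h + h by rewrite -natr1; ring.
have [h_gt0|] := ltP 0 h.
  rewrite ltrDl h_gt0 -EFinB -EFinM -EFinD addrAC subrr add0r; congr (_%:E).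
  by rewrite (mulrC (c n)).
move=> h_le0; have -> : h = 0 by apply/le_anti/andP.
by rewrite addr0 ltxx mule0 !mul0r adde0 addr0.
Qed.

End Character.

(** * The heat kernel on spheres *)

Section HeatKernel.
Variables (p : nat) (R : realType) (b sigma : R).
Hypotheses (p1 : (1 < p)%N) (b_gt0 : 0 < b) (sigma_gt0 : 0 < sigma).
Let p0 : (0 < p)%N := ltnW p1.
Let pR_gt0 : 0 < (p%:R : R). Proof. by rewrite ltr0n. Qed.
Let pR_neq0 : (p%:R : R) != 0. Proof. by rewrite gt_eqF. Qed.
Let pR_gt1 : 1 < (p%:R : R). Proof. by rewrite ltr1n. Qed.
Let pX_gt0 (n : int) : 0 < (p%:R : R) ^ n. Proof. exact: exprz_gt0. Qed.
Local Notation xi := (@Qp_of_real p R).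
Local Notation leb := (@lebesgue_measure R).
Local Notation cell := (@digit_cell p R).

(** The Fourier transform of the heat kernel at time [s], read along the digit map; [shell s k] is
    its value on the sphere of radius p^k. *)
Definition phi (s u : R) : R := expR (- (sigma * s * (Qp_abs R (xi u) `^ b))).
Definition shell (s : R) (k : int) : R :=
  expR (- (sigma * s * (((p%:R : R) ^ k) `^ b))).
Definition mass (s : R) (D : set R) : R := fine (\int[leb]_(u in D) (phi s u)%:E)%E.
(** The interval of reals that the digit map sends into the ball of radius p^k around 0. *)
Definition pball (k : int) : set R := [set` `[0, (p%:R : R) ^ k[%R].

Lemma in_pball k u : pball k u = (0 <= u < p%:R ^ k) :> Prop.
Proof. by rewrite /pball /= in_itv. Qed.

Lemma phi_shell s u k : (p%:R : R) ^ (k - 1) <= u < p%:R ^ k -> phi s u = shell s k.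
Proof. by move=> h; rewrite /phi (Qp_abs_val R p1 (isval_xi p1 h)) opprK. Qed.

Lemma Qp_abs_xi_le u k : 0 <= u -> (Qp_abs R (xi u) <= p%:R ^ k <-> u < p%:R ^ k).
Proof. by move=> u0; rewrite Qp_abs_le // cell_origin // opprK. Qed.

(** If [xi u] has norm p^k, then [u] is in the interval [pball k]; if [xi u] is 0, then [u] is in
    all these intervals and is 0. This lets a function of the real variable dominate [phi]. *)
Lemma Qp_abs_xi_ge u : 0 <= u -> u <= Qp_abs R (xi u).
Proof.
move=> u0; have [h|[v hv]] := Qp_valP (xi u).
  have hu (n : nat) : u < p%:R ^ (- n%:Z).
    by apply/Qp_abs_xi_le => //; apply/Qp_abs_le => //; exact: h.
  rewrite Qp_abs_zero //; rewrite leNgt; apply/negP => ugt0.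
  have := upper_nthrootP (leqnn (Num.Def.archi_bound u^-1)).
  set N := Num.Def.archi_bound _ => h2.
  have h3 : u^-1 < p%:R ^+ N.
    by apply: lt_le_trans h2 _; rewrite lerXn2r ?nnegrE ?ler_nat.
  have := hu N; rewrite -invr_expz -[_ ^ N%:Z]/(_ ^+ N) ltNge => /negP; apply.
  by rewrite -[u]invrK lef_pV2 ?posrE ?invr_gt0 ?exprn_gt0 // ltW.
have /(Qp_abs_xi_le _ u0)/ltW : Qp_abs R (xi u) <= p%:R ^ (- v).
  by rewrite (Qp_abs_val R p1 hv).
by rewrite -(Qp_abs_val R p1 hv).
Qed.

Lemma radial_Qp_abs : radial (Qp0 p) (fun x => Qp_abs R x).
Proof.
move=> x x' h; have [hx|[v hv]] := Qp_valP x; have [hx'|[v' hv']] := Qp_valP x'.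
- by rewrite !Qp_abs_zero.
- by have /h/(isval_close _ hv') := hx (v' + 1); lia.
- by have /h/(isval_close _ hv) := hx' (v + 1); lia.
- rewrite (Qp_abs_val R p1 hv) (Qp_abs_val R p1 hv').
  have /h/(isval_close _ hv') : Qp_close v x (Qp0 p) by apply/(isval_close _ hv).
  have /h/(isval_close _ hv) : Qp_close v' x' (Qp0 p) by apply/(isval_close _ hv').
  by move=> ? ?; congr (_ ^ (- _)); lia.
Qed.

Lemma measurable_phi s : measurable_fun (`[0, +oo[ : set R) (phi s).
Proof.
apply: (@measurable_radial p R p1 _ _ (Qp0 p)
  (fun y => expR (- (sigma * s * (Qp_abs R y `^ b))))).
by move=> x x' /radial_Qp_abs ->.
Qed.

Lemma phi_gt0 s u : 0 < phi s u. Proof. exact: expR_gt0. Qed.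

Lemma shell_gt0 s k : 0 < shell s k. Proof. exact: expR_gt0. Qed.

Section PositiveTime.
Variable s : R.
Hypothesis s_gt0 : 0 < s.
Let ss_gt0 : 0 < sigma * s. Proof. exact: mulr_gt0. Qed.

Lemma shell_lt k k' : k < k' -> shell s k' < shell s k.
Proof.
move=> kk'; rewrite ltr_expR ltrN2 ltr_pM2l // gt0_ltr_powR ?nnegrE ?ltW //.
by rewrite ltr_eXz2l.
Qed.

Lemma shell_le k k' : k <= k' -> shell s k' <= shell s k.
Proof. by rewrite le_eqVlt => /predU1P[->//|/shell_lt/ltW]. Qed.

Lemma phi_ge u k : 0 <= u < p%:R ^ k -> shell s k <= phi s u.
Proof.
move=> /andP[u0 uk]; rewrite ler_expR lerN2 ler_pM2l //.
rewrite ge0_ler_powR ?nnegrE ?(ltW b_gt0) ?Qp_abs_ge0 ?(ltW (pX_gt0 _)) //.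
exact/(Qp_abs_xi_le _ u0).
Qed.

Lemma phi_le1 u : phi s u <= 1.
Proof.
rewrite -expR0 ler_expR oppr_le0 mulr_ge0 ?powR_ge0 //; exact: ltW.
Qed.

(* [expR v >= v^n / n!] with [b * n >= 2] bounds [phi] by a multiple of
   [1 / (1 + u^2)]. *)
Lemma phi_le : exists C : R, forall u, 0 <= u -> phi s u <= C * (oneDsqr u)^-1.
Proof.
pose n := Num.Def.archi_bound (2 / b).
have hn : 2 <= b * n.+1%:R.
  have h : 2 / b < n%:R by rewrite archi_boundP // divr_ge0 // ltW.
  have : 2 / b < n.+1%:R by apply: lt_le_trans h _; rewrite ler_nat.
  by rewrite ltr_pdivrMr // mulrC => /ltW.
have sn0 : 0 < (sigma * s) ^+ n.+1 by exact: exprn_gt0.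
pose D : R := n.+1`!%:R / (sigma * s) ^+ n.+1.
have D0 : 0 < D by rewrite divr_gt0 // ltr0n fact_gt0.
exists (2 + D) => u u0; rewrite ler_pdivlMr; last first.
  by apply: lt_le_trans (oneDsqr_ge1 u).
set V := sigma * s * (u `^ b).
have V0 : 0 <= V by rewrite mulr_ge0 ?powR_ge0 // ltW.
have phV : phi s u * expR V <= 1.
  rewrite -expRD -expR0 ler_expR addrC subr_le0 ler_pM2l //.
  rewrite ge0_ler_powR ?nnegrE ?Qp_abs_ge0 ?(ltW b_gt0) //; exact: Qp_abs_xi_ge.
have ph0 := phi_gt0 s u; have ph1 := phi_le1 u.
rewrite /oneDsqr mulrDr mulr1; have [u1|u1] := leP u 1.
  have : phi s u * u ^+ 2 <= 1 by rewrite mulr_ile1 ?expr_le1 // ?sqr_ge0 // ltW.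
  by lra.
suff : phi s u * u ^+ 2 <= D by lra.
have hu : u ^+ 2 <= D * expR V.
  have u2 : u ^+ 2 <= (u `^ b) ^+ n.+1.
    rewrite -!powR_mulrn ?powR_ge0 // -powRrM ler_powR //; exact: ltW.
  apply: (le_trans u2); rewrite /D mulrAC ler_pdivlMr // mulrC -exprMn -/V.
  have fact0 : 0 < n.+1`!%:R :> R by rewrite ltr0n fact_gt0.
  have := expR_ge1Dxn n V0; rewrite -ler_pdivrMl // mulrC => h.
  by apply: le_trans h; rewrite lerDr.
apply: (@le_trans _ _ (phi s u * (D * expR V))); first by rewrite ler_pM2l.
by rewrite mulrCA -[leRHS]mulr1 ler_pM2l.
Qed.

Lemma integrable_phi : leb.-integrable (`[0, +oo[ : set R) (EFin \o phi s).
Proof.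
have [C hC] := phi_le.
have moneD (D : set R) : measurable_fun D (fun u : R => (oneDsqr u)^-1).
  apply: measurable_funTS; apply: continuous_measurable_fun.
  exact: continuous_oneDsqrV.
apply: (@le_integrable _ _ R leb `[0, +oo[%classic _ _
   (fun u => C%:E * ((oneDsqr u)^-1)%:E)%E) => //.
- by apply/measurable_EFinP; exact: measurable_phi.
- move=> u /=; rewrite in_itv /= andbT => u0; rewrite lee_fin.
  by rewrite ger0_norm ?(ltW (phi_gt0 _ _)) // (le_trans (hC _ u0)) // ler_norm.
apply: integrableZl => //; apply/integrableP; split.
  by apply/measurable_EFinP; exact: moneD.
under eq_integral => u _.
  rewrite gee0_abs; last by rewrite lee_fin invr_ge0 (le_trans _ (oneDsqr_ge1 u)).
  over.
by rewrite integral0y_oneDsqr ltry.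
Qed.

Lemma mass_EFin (D : set R) : measurable D -> D `<=` `[0, +oo[ ->
  (\int[leb]_(u in D) (phi s u)%:E = (mass s D)%:E)%E.
Proof.
move=> mD Dsub; rewrite fineK //; apply: integrable_fin_num => //.
apply: integrableS integrable_phi => //.
Qed.

Lemma pball_sub k : pball k `<=` `[0, +oo[.
Proof. by move=> u; rewrite in_pball /= in_itv /= => /andP[->]. Qed.

Lemma measurable_pball k : measurable (pball k).
Proof. exact: measurable_itv. Qed.

Lemma mass_mono (D E : set R) : measurable D -> measurable E -> D `<=` E ->
  E `<=` `[0, +oo[ -> mass s D <= mass s E.
Proof.
move=> mD mE DE Esub; rewrite -lee_fin -!mass_EFin //; last exact: subset_trans Esub.
apply: ge0_subset_integral => //; last by move=> u _; rewrite lee_fin ltW // phi_gt0.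
apply/measurable_EFinP; apply: measurable_funS (measurable_phi s) => //.
Qed.

Lemma mass_ge0 (D : set R) : 0 <= mass s D.
Proof.
by apply: fine_ge0; apply: integral_ge0 => u _; rewrite lee_fin ltW // phi_gt0.
Qed.

Lemma measurable_phiS (D : set R) : measurable D -> D `<=` `[0, +oo[ ->
  measurable_fun D (EFin \o phi s).
Proof.
move=> mD Dsub; apply/measurable_EFinP.
exact: measurable_funS (measurable_phi s).
Qed.

Lemma leb_itv_co (x y : R) : x <= y -> leb `[x, y[%classic = (y - x)%:E.
Proof.
rewrite lebesgue_measure_itv /= lte_fin le_eqVlt => /predU1P[->|->].
  by rewrite ltxx subrr.
by rewrite EFinB.
Qed.

Lemma leb_pball k : leb (pball k) = ((p%:R : R) ^ k)%:E.
Proof. by rewrite leb_itv_co ?subr0 // ltW. Qed.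

Lemma mass_pballS k : mass s (pball (k + 1)) =
  mass s (pball k) + (p%:R ^ (k + 1) - p%:R ^ k) * shell s (k + 1).
Proof.
apply: EFin_inj; rewrite EFinD -!mass_EFin; try exact: measurable_pball;
  try exact: pball_sub.
have kk : (p%:R : R) ^ k < p%:R ^ (k + 1) by rewrite ltr_eXz2l //; lia.
have -> : pball (k + 1) = pball k `|` `[p%:R ^ k, p%:R ^ (k + 1)[.
  apply/seteqP; split=> u; rewrite /setU /mkset !in_pball /= in_itv /=.
    by move=> /andP[-> ->]; rewrite andbT /=; apply/orP; case: ltP.
  move=> [|] /andP[h1 h2]; first by rewrite h1 (lt_trans h2).
  by rewrite h2 (le_trans _ h1) // ltW.
rewrite integral_setU //=.
- congr (_ + _)%E; rewrite (eq_integral (cst (shell s (k + 1))%:E)).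
    by rewrite integral_cst //= leb_itv_co ?ltW // -EFinM mulrC.
  move=> u /set_mem /=; rewrite in_itv /= => h; congr (_%:E); apply: phi_shell.
  by rewrite addrK.
- exact: measurable_pball.
- apply: measurable_phiS; first by apply: measurableU => //; exact: measurable_pball.
  move=> u [/pball_sub//|/=]; rewrite !in_itv /= => /andP[h _]; rewrite andbT.
  by apply: le_trans h; exact: ltW.
- rewrite disj_set2E; apply/eqP/seteqP; split=> u //.
  rewrite /setI /mkset in_pball /= in_itv /=.
  by move=> [/andP[_ h1] /andP[h2 _]]; move: h1; rewrite ltNge h2.
Qed.

Lemma mass_pball_ge k : p%:R ^ k * shell s k <= mass s (pball k).
Proof.
rewrite -lee_fin -mass_EFin; try exact: measurable_pball; try exact: pball_sub.
rewrite -[leLHS](_ : (\int[leb]_(u in pball k) (shell s k)%:E = _)%E); last first.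
  rewrite integral_cst /=; last exact: measurable_pball.
  by rewrite leb_pball -EFinM mulrC.
apply: ge0_le_integral => //.
- exact: measurable_pball.
- by move=> u _; rewrite lee_fin ltW // shell_gt0.
- by apply: measurable_phiS; [exact: measurable_pball|exact: pball_sub].
- by move=> u; rewrite in_pball => h; rewrite lee_fin; exact: phi_ge.
Qed.

Lemma mass_pball_le_total k : mass s (pball k) <= mass s `[0, +oo[.
Proof.
apply: mass_mono => //; first exact: measurable_pball.
exact: pball_sub.
Qed.

Lemma mass_pball_gt0 k : 0 < mass s (pball k).
Proof. by apply: lt_le_trans (mass_pball_ge k); rewrite mulr_gt0 // shell_gt0. Qed.

Lemma rhoE (x : Qp p) : rho b sigma s x =
  fine (\int[leb]_(u in `[0%R, +oo[) (chi_re R (Qp_mul x (xi u)) * phi s u)%:E)%E.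
Proof. by []. Qed.

Lemma measurable_chi_phi x :
  measurable_fun (`[0, +oo[ : set R) (fun u => chi_re R (Qp_mul x (xi u)) * phi s u).
Proof.
by apply: measurable_funM; [exact: measurable_chi_re|exact: measurable_phi].
Qed.

Lemma integrable_chi_phi x : leb.-integrable (`[0, +oo[ : set R)
  (fun u => (chi_re R (Qp_mul x (xi u)) * phi s u)%:E).
Proof.
apply: le_integrable integrable_phi => //.
  by apply/measurable_EFinP; exact: measurable_chi_phi.
move=> u _; rewrite lee_fin normrM ler_piMl //.
by rewrite ler_norml cos_geN1 cos_le1.
Qed.

Lemma rho_zero (x : Qp p) : (forall n, Qp_close n x (Qp0 p)) ->
  rho b sigma s x = mass s `[0, +oo[.
Proof.
move=> hx; rewrite rhoE; congr fine; apply: eq_integral => u _.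
rewrite (chi_re1 R p1 (K := - lowb (xi u))) ?mul1r //.
by rewrite opprK => k /digit_lowb ->.
Qed.

(** The offset [d0] serves two uses: [d0 = 0] with [p] steps for a full block, and [d0 = 1] with
    [p - 1] steps for the block at 0, whose first step is not a region of constant [phi]. *)
Lemma integral_chi_phi_stairs x v (M : nat) (theta : R) (n d0 : nat) (c : R) :
  (forall u, cell (- v - 1) M%:Z u -> chi_re R (Qp_mul x (xi u)) =
    cos (theta + (digit (xi u) (- v - 1))%:R * (2 * pi * (digit x v)%:R / p%:R))) ->
  (d0 + n <= p)%N ->
  (forall u, cell (- v - 1) M%:Z u ->
     M%:R * p%:R ^ (v + 1) + d0%:R * p%:R ^ v <= u -> phi s u = c) ->
  let a : R := M%:R * p%:R ^ (v + 1) + d0%:R * p%:R ^ v in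
  (\int[leb]_(u in `[a, (a + n%:R * p%:R ^ v)%R[)
      (chi_re R (Qp_mul x (xi u)) * phi s u)%:E =
   (p%:R ^ v * \sum_(d < n)
     cos (theta + (d0 + d)%:R * (2 * pi * (digit x v)%:R / p%:R)) * c)%:E)%E.
Proof.
move=> ht dn hc a.
have hq : p%:R ^ (v + 1) = p%:R * p%:R ^ v :> R by rewrite expfzDr // expr1z mulrC.
have a0 : 0 <= a by rewrite addr_ge0 // mulr_ge0 // ltW.
apply: (@integral_stairs R (fun u => chi_re R (Qp_mul x (xi u)) * phi s u) a
  (p%:R ^ v) n (fun d => cos (theta + (d0 + d)%:R *
    (2 * pi * (digit x v)%:R / p%:R)) * c)); first exact: ltW.
  apply: measurable_funS (measurable_chi_phi x) => // u /=.
  by rewrite !in_itv /= andbT => /andP[h _]; apply: le_trans h.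
move=> d u dn' /andP[u1 u2].
have du : (d0 + d < p)%N by apply: leq_trans dn; rewrite ltn_add2l.
have cu : cell (- v) (p%:Z * M%:Z + (d0 + d)%N%:Z) u.
  rewrite /digit_cell /= in_itv /= opprK; apply/andP; split.
    apply: le_trans u1; rewrite /a hq intrD intrM PoszD intrD -!pmulrn.
    by rewrite le_eqVlt; apply/orP; left; apply/eqP; ring.
  apply: lt_le_trans u2 _; rewrite /a hq !intrD intrM -!pmulrn -natr1.
  by rewrite le_eqVlt; apply/orP; left; apply/eqP; ring.
have [h1 h2] := cell_split p1 du (le0z_nat M) cu.
rewrite ht // h2 hc //; apply: le_trans u1; rewrite lerDl mulr_ge0 //; exact: ltW.
Qed.

(** In units of the cell length the endpoints are the integers [M] and [M + 1]. If p^j <= M <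
    p^(j+1), then also M + 1 <= p^(j+1), so the cell stays within one sphere. *)
Lemma phi_cell v (M : nat) : (0 < M)%N ->
  exists c, forall u, cell (- v - 1) M%:Z u -> phi s u = c.
Proof.
move=> M0; have /andP[j1 j2] := trunc_log_bounds p1 M0.
set j := trunc_log p M in j1 j2.
exists (shell s (v + 1 + j%:Z + 1)) => u; rewrite /digit_cell /= in_itv /=.
rewrite opprB opprK addrC => /andP[u1 u2]; apply: phi_shell; apply/andP; split.
  apply: le_trans u1; rewrite addrK expfzDr // mulrC addrC ler_pM2r //.
  by rewrite -pmulrn -exprnP -natrX ler_nat.
apply: lt_le_trans u2 _; rewrite -addrA (expfzDr (v + 1)) // [leRHS]mulrC ler_pM2r //.
by rewrite -!PoszD -pmulrn -exprnP -natrX ler_nat !addn1.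
Qed.

(* Stairs of equal [phi] come in blocks of [p] on which the characters cancel,
   except in the first block, whose first step has [chi = 1]. *)
Lemma rho_val (x : Qp p) v : isval x v ->
  rho b sigma s x = mass s (pball v) - p%:R ^ v * shell s (v + 1).
Proof.
move=> hv; rewrite rhoE; pose al : R := 2 * pi * (digit x v)%:R / p%:R.
pose F (i : nat) := cell (- v - 1) i%:Z.
have dp : (0 < digit x v < p)%N.
  by have := digit_le x v; case: hv => /eqP; rewrite -lt0n => -> _ /=; lia.
have FU : `[0, +oo[%classic = F 0%N `|` \bigcup_i F i.+1.
  apply/seteqP; split=> u; rewrite /= in_itv /= andbT.
    move=> u0; have : F (absz (Num.floor (u * (p%:R : R) ^ (- v - 1)))) u.
      by apply/in_cell => //; rewrite gez0_abs // floor_ge0 mulr_ge0 // ltW.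
    by case: absz => [|i]; [left|right; exists i].
  by move=> [|[i _]]; exact: cell_ge0.
have mF i : measurable (F i) by exact: measurable_cell.
have disjF i j u : F i u -> F j u -> i = j.
  by move=> /in_cell h1 /in_cell h2; have := h1 p1; rewrite (h2 p1) => -[].
have tF : trivIset setT (fun i => F i.+1).
  apply/trivIsetP => i j _ _ ij; apply/seteqP; split=> u // -[h1 h2].
  by move/eqP: ij; case; have [] := disjF _ _ _ h1 h2.
have hq : p%:R ^ (v + 1) = p%:R * p%:R ^ v :> R by rewrite expfzDr // expr1z mulrC.
have FE i : F i = `[(i%:R * (p%:R : R) ^ (v + 1) + 0%:R * p%:R ^ v)%R,
   (i%:R * (p%:R : R) ^ (v + 1) + 0%:R * p%:R ^ v + p%:R * p%:R ^ v)%R[%classic.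
  rewrite /F /digit_cell opprB opprK mul0r addr0 intrD -!pmulrn mulrDl mul1r.
  by rewrite [1 + v]addrC -hq.
have intF i : (\int[leb]_(u in F i.+1)
    (chi_re R (Qp_mul x (xi u)) * phi s u)%:E = 0)%E.
  have [theta ht] := chi_re_cell R p1 hv (M := i.+1%:Z) isT.
  have [c hc] := @phi_cell v i.+1 isT.
  rewrite FE (integral_chi_phi_stairs (theta := theta) (c := c)) //; last first.
    by move=> u hu _; exact: hc.
  by rewrite -big_distrl /= sum_cos_eq0 // mul0r mulr0.
have int0 : (\int[leb]_(u in F 0%N) (chi_re R (Qp_mul x (xi u)) * phi s u)%:E =
    (mass s (pball v) - p%:R ^ v * shell s (v + 1))%:E)%E.
  have [theta ht] := chi_re_cell R p1 hv (M := 0) isT.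
  pose a : R := 0%:R * p%:R ^ (v + 1) + 1%:R * p%:R ^ v.
  have aE : a = p%:R ^ v by rewrite /a mul0r add0r mul1r.
  have chi1 u : pball v u -> chi_re R (Qp_mul x (xi u)) = 1.
    rewrite in_pball => /andP[u0 uv]; apply: (chi_re1 R p1 (K := v)).
      exact/(isval_close _ hv).
    by apply/cell_origin; rewrite ?opprK.
  have p1E : p.-1%:R * p%:R ^ v + p%:R ^ v = p%:R ^ (v + 1) :> R.
    have pE : p%:R = p.-1%:R + 1 :> R by rewrite natr1 prednK.
    by rewrite hq [X in _ = X * _]pE mulrDl mul1r.
  have F0E : F 0%N = pball v `|` `[a, (a + p.-1%:R * p%:R ^ v)%R[.
    rewrite FE !mul0r !add0r -hq aE [_ ^ v + _]addrC p1E.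
    apply/seteqP; split=> u; rewrite /setU /mkset in_pball /= !in_itv /=.
      by move=> /andP[-> ->]; rewrite andbT /=; apply/orP; case: ltP.
    have vv : (p%:R : R) ^ v < p%:R ^ (v + 1) by rewrite ltr_eXz2l //; lia.
    move=> [|] /andP[h1 h2]; first by rewrite h1 (lt_trans h2).
    by rewrite h2 (le_trans _ h1) // ltW.
  rewrite F0E integral_setU //=; first last.
  - rewrite disj_set2E; apply/eqP/seteqP; split=> u //.
    rewrite /setI /mkset in_pball /= in_itv /= aE.
    by move=> [/andP[_ h1] /andP[h2 _]]; move: h1; rewrite ltNge h2.
  - rewrite -F0E; apply/measurable_EFinP.
    apply: measurable_funS (measurable_chi_phi x) => //.
    by rewrite FU; exact: subsetUl.
  - exact: measurable_pball.
  rewrite EFinB; congr (_ + _)%E.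
    rewrite -mass_EFin; [|exact: measurable_pball|exact: pball_sub].
    by apply: eq_integral => u /set_mem /chi1 ->; rewrite mul1r.
  rewrite (integral_chi_phi_stairs (c := shell s (v + 1)) ht); first last.
  - move=> u; rewrite /digit_cell /= in_itv /= mul0r opprB opprK add0r mul1r.
    move=> /andP[_ u1] u2; apply: phi_shell; rewrite addrK.
    by move: u2; rewrite mul0r add0r mul1r => ->; rewrite addrC.
  - by rewrite add1n prednK.
  rewrite -EFinN -mulrN; congr ((_ * _)%:E); rewrite -big_distrl /=.
  (* The cosines over all [p] digits sum to 0 and the one of digit 0 is 1, so the remaining [p - 1]
     steps contribute -1 times the length of a step times [shell]. *)
  have := sum_cos_eq0 p1 theta dp; rewrite -(big_mkord xpredT
    (fun d : nat => cos (theta + d%:R * (2 * pi * (digit x v)%:R / p%:R)))).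
  rewrite (big_ltn p0) big_add1 big_mkord.
  have c0 : cos (theta + 0%:R * al) = 1.
    have h0 : cell (- v - 1) 0 0.
      by rewrite /digit_cell /= in_itv /= mul0r lexx mulr_gt0.
    rewrite -[RHS](chi1 0) ?ht //; last by rewrite in_pball lexx pX_gt0.
    congr (cos (theta + _%:R * _)); apply/esym.
    have : Qp_close (- v) (xi 0) (Qp0 p) by apply/cell_origin.
    by apply; lia.
  rewrite c0 => /eqP; rewrite addrC addr_eq0 => /eqP hs.
  by rewrite -[RHS]mulN1r -hs.
have mU : measurable (\bigcup_i F i.+1) by apply: bigcup_measurable.
rewrite FU integral_setU //.
- rewrite int0 integral_bigcup.
  + by rewrite eseries0 ?adde0 // => i _ _; exact: intF.
  + exact: tF.
  + by move=> i; exact: mF.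
  + apply: (@integrableS _ _ R leb `[0, +oo[%classic) (integrable_chi_phi x) => //.
    by rewrite FU; exact: subsetUr.
- exact: mF.
- rewrite -FU; apply/measurable_EFinP; exact: measurable_chi_phi.
- rewrite disj_set2E; apply/eqP/seteqP; split=> u // -[h1 [i _ h2]].
  by have := disjF _ _ _ h1 h2.
Qed.

Lemma rho_radial (x x' : Qp p) :
  (forall n, Qp_close n x (Qp0 p) <-> Qp_close n x' (Qp0 p)) ->
  rho b sigma s x = rho b sigma s x'.
Proof.
move=> h; have [hx|[v hv]] := Qp_valP x.
  by rewrite !rho_zero // => n; apply/h.
rewrite (rho_val hv); suff hv' : isval x' v by rewrite (rho_val hv').
have cv : Qp_close v x' (Qp0 p) by apply/h/(isval_close _ hv).
split=> // dv; have : Qp_close (v + 1) x' (Qp0 p) by apply/closeS.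
by move/h/(isval_close _ hv); lia.
Qed.

(** Although the integrand oscillates, [rho_val] leaves a difference that is nonnegative because
    [phi] decreases with the norm: p^v shell(v+1) <= p^v shell(v) <= mass of [pball v]. *)
Lemma rho_ge0 (x : Qp p) : 0 <= rho b sigma s x.
Proof.
have [hx|[v hv]] := Qp_valP x; first by rewrite rho_zero // mass_ge0.
rewrite (rho_val hv) subr_ge0; apply: le_trans (mass_pball_ge v).
by rewrite ler_pM2l // shell_le //; lia.
Qed.

Lemma rho_gt0 (x : Qp p) : 0 < rho b sigma s x.
Proof.
have [hx|[v hv]] := Qp_valP x.
  by rewrite rho_zero // (lt_le_trans (mass_pball_gt0 0)) // mass_pball_le_total.
rewrite (rho_val hv) subr_gt0; apply: lt_le_trans (mass_pball_ge v).
by rewrite ltr_pM2l // shell_lt //; lia.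
Qed.

Lemma rho_le_total (x : Qp p) : rho b sigma s x <= mass s `[0, +oo[.
Proof.
have [hx|[v hv]] := Qp_valP x; first by rewrite rho_zero.
rewrite (rho_val hv); apply: le_trans (mass_pball_le_total v).
by rewrite gerBl mulr_ge0 ?(ltW (shell_gt0 _ _)) // ltW.
Qed.

End PositiveTime.

Lemma massE s (D : set R) : mass s D = \int[leb]_(u in D) phi s u.
Proof. by []. Qed.

End HeatKernel.

Local Opaque rho mass shell.

(** * Haar measure of balls *)

Section HaarBalls.
Variables (p : nat) (R : realType).
Implicit Types (k : int).
Hypothesis p1 : (1 < p)%N.
Local Notation xi := (@Qp_of_real p R).
Local Notation leb := (@lebesgue_measure R).
Local Notation ball := (Qp_ball R).

Definition real_of (U : set (Qp p)) : set R := [set u | 0 <= u /\ U (xi u)].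

Lemma real_of_ball k (z : Qp p) :
  exists2 N : int, 0 <= N & real_of (ball k z) = @digit_cell p R (- k) N.
Proof.
have [N N0 hN] := cell_ball R p1 z (- k); exists N => //; rewrite -hN /real_of.
by rewrite Qp_ballE.
Qed.

Lemma measurable_real_of_ball k (z : Qp p) : measurable (real_of (ball k z)).
Proof. by have [N _ ->] := real_of_ball k z; exact: measurable_cell. Qed.

Lemma leb_real_of_ball k (z : Qp p) : leb (real_of (ball k z)) = ((p%:R : R) ^ k)%:E.
Proof. by have [N _ ->] := real_of_ball k z; rewrite measure_cell // opprK. Qed.

Lemma real_of_sub U : real_of U `<=` `[0, +oo[.
Proof. by move=> u [u0 _]; rewrite /= in_itv /= u0. Qed.

Lemma real_ofC U : real_of (~` U) = `[0, +oo[ `\` real_of U.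
Proof.
apply/seteqP; split=> u; rewrite /real_of /setD /= in_itv /= andbT.
  by move=> [u0 Uu]; split=> // -[].
by move=> [u0 h]; split=> // Uu; apply: h.
Qed.

Lemma measurable_real_ofC U : measurable (real_of U) -> measurable (real_of (~` U)).
Proof. by move=> mU; rewrite real_ofC; exact: measurableD. Qed.

Lemma haar_integral_indic (U : set (Qp p)) (f : Qp p -> R) (G : Qp p -> \bar R) :
  measurable (real_of U) ->
  haar_integral (fun x => ((\1_U x * f x)%:E * G x)%E) =
  (\int[leb]_(u in real_of U) ((f (xi u))%:E * G (xi u)))%E.
Proof.
move=> mU; rewrite /haar_integral integral_mkcond [RHS]integral_mkcond.
apply: eq_integral => u _; rewrite !patchE.
have [hu|hu] := boolP (u \in real_of U).
  have [u0 Uu] := set_mem hu.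
  by rewrite mem_set ?indicE ?mem_set ?mul1r //= in_itv /= u0.
case: ifPn => // u0; rewrite indicE memNset ?mul0r ?mul0e //.
move=> Uu; move/negP: hu; apply; apply/mem_set; split=> //.
by move/set_mem: u0; rewrite /= in_itv /= andbT.
Qed.

Lemma ball_center k (z : Qp p) : ball k z z.
Proof. by rewrite Qp_ballE. Qed.

Lemma ball_eq k (y z : Qp p) : ball k z y -> ball k y = ball k z.
Proof.
rewrite !(Qp_ballE R p1) /= => yz; apply/seteqP; split=> w /= h i ki.
  by rewrite h // yz.
by rewrite h // -yz.
Qed.

Lemma ball_mono k k' (z : Qp p) : k <= k' -> ball k z `<=` ball k' z.
Proof. by rewrite !(Qp_ballE R p1) => kk' w h i hi; apply: h; lia. Qed.

Lemma ball_sub_ball k k' (y z : Qp p) : k <= k' -> ball k' z y -> ball k y `<=` ball k' z.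
Proof. by move=> kk' /ball_eq <-; exact: ball_mono. Qed.

End HaarBalls.

(** * Transition probabilities into balls *)

Section BallProbabilities.
Variables (p : nat) (R : realType) (b sigma : R).
Hypotheses (p1 : (1 < p)%N) (b_gt0 : 0 < b) (sigma_gt0 : 0 < sigma).
Let pR_gt0 : 0 < (p%:R : R). Proof. by rewrite ltr0n ltnW. Qed.
Let pR_neq0 : (p%:R : R) != 0. Proof. by rewrite gt_eqF. Qed.
Let pX_gt0 (n : int) : 0 < (p%:R : R) ^ n. Proof. exact: exprz_gt0. Qed.
Local Notation xi := (@Qp_of_real p R).
Local Notation leb := (@lebesgue_measure R).
Local Notation realof := (@real_of p R).
Local Notation ball := (Qp_ball R).
Local Notation rho := (rho b sigma).
Local Notation mass := (@mass p R b sigma).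
Local Notation shell := (@shell p R b sigma).
Local Notation pball := (@pball p R).

(** The probability of passing from [z] into [U] in time [s]. *)
Definition hit (s : R) (U : set (Qp p)) (z : Qp p) : \bar R :=
  (\int[leb]_(u in realof U) (rho s (Qp_sub (xi u) z))%:E)%E.

Section PositiveTime.
Variable s : R.
Hypothesis s_gt0 : 0 < s.

Lemma rho_sub_radial (x x' z z' : Qp p) :
  (forall n, Qp_close n x z <-> Qp_close n x' z') ->
  rho s (Qp_sub x z) = rho s (Qp_sub x' z').
Proof. move=> h; apply: (rho_radial p1 b_gt0 sigma_gt0 s_gt0) => n.
by split=> /(close_sub p1)/h/(close_sub p1). Qed.

Lemma measurable_rho_sub (z : Qp p) (D : set R) : D `<=` `[0, +oo[ ->
  measurable_fun D (fun u => rho s (Qp_sub (xi u) z)).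
Proof.
move=> Dsub; apply: measurable_funS Dsub _ => //.
apply: (@measurable_radial p R p1 _ _ z (fun x => rho s (Qp_sub x z))).
by move=> x x' h; exact: rho_sub_radial.
Qed.

Lemma hit_ge0 U z : (0 <= hit s U z)%E.
Proof. by apply: integral_ge0 => u _; rewrite lee_fin rho_ge0. Qed.

Lemma hit_ball_le k (y z : Qp p) : (hit s (ball k y) z <= (p%:R ^ k * mass s `[0, +oo[)%:E)%E.
Proof.
have mB := measurable_real_of_ball (R := R) p1 k y.
rewrite EFinM -(leb_real_of_ball R p1 k y) muleC -integral_cst //.
apply: ge0_le_integral => //.
- by move=> u _; rewrite lee_fin rho_ge0.
- by apply/measurable_EFinP; apply: measurable_rho_sub; exact: real_of_sub.
- by move=> u _; rewrite lee_fin rho_le_total.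
Qed.

Lemma hit_ball_fin k (y z : Qp p) : hit s (ball k y) z \is a fin_num.
Proof.
rewrite ge0_fin_numE ?hit_ge0 //; apply: le_lt_trans (hit_ball_le k y z) _.
exact: ltry.
Qed.

Lemma hit_far k (y z : Qp p) : ~ ball k y z ->
  hit s (ball k y) z = (p%:R ^ k * rho s (Qp_sub y z))%:E.
Proof.
move=> nz; have mB := measurable_real_of_ball (R := R) p1 k y.
transitivity (\int[leb]_(u in realof (ball k y))
    (cst (rho s (Qp_sub y z))%:E u))%E; last first.
  rewrite integral_cst /=; last exact: mB.
  by rewrite (leb_real_of_ball R p1 k y) -EFinM mulrC.
apply: eq_integral => u /set_mem [_]; rewrite (Qp_ballE R p1) => hu.
rewrite [RHS]/=.
apply: (congr1 EFin).
apply: rho_sub_radial.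
move=> n.
move: nz; rewrite Qp_ballE //= => nz.
have [nk|kn] := leP n (- k).
  by split=> h i hi; [rewrite -hu ?h //|rewrite hu ?h //]; lia.
have far w : Qp_close n w z -> Qp_close (- k) w y -> False.
  by move=> h1 h2; apply: nz => i hi; rewrite -h2 // h1 //; lia.
by split=> h; exfalso; apply: (far _ h).
Qed.

Lemma hit_shell k (z : Qp p) : hit s (ball (k + 1) z) z = (hit s (ball k z) z +
  ((p%:R ^ (k + 1) - p%:R ^ k) *
   (mass s (pball (- k - 1)) - p%:R ^ (- k - 1) * shell s (- k)))%:E)%E.
Proof.
have mB j := measurable_real_of_ball (R := R) p1 j z.
have sub : realof (ball k z) `<=` realof (ball (k + 1) z).
  by move=> u [u0 hu]; split=> //; apply: ball_mono hu => //; lia.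
rewrite /hit -(setDUK sub) integral_setU //=; first last.
- by rewrite disj_set2E setDIK.
- apply/measurable_EFinP; apply: measurable_rho_sub.
  by move=> u [/real_of_sub//|[/real_of_sub]].
- by apply: measurableD; exact: mB.
- exact: mB.
congr (_ + _)%E.
rewrite (eq_integral (cst (mass s (pball (- k - 1)) -
    p%:R ^ (- k - 1) * shell s (- k))%:E)); last first.
  move=> u /set_mem [[u0]]; rewrite Qp_ballE //= => h1 h2; congr (_%:E).
  have hv : isval (Qp_sub (xi u) z) (- k - 1).
    have h3 : ~ Qp_close (- k) (Qp_sub (xi u) z) (Qp0 p).
      by rewrite close_sub // => h; apply: h2; split=> //; rewrite Qp_ballE.
    have h4 : Qp_close (- k - 1) (Qp_sub (xi u) z) (Qp0 p).
      by rewrite close_sub // -opprD.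
    split=> // d0; apply: h3; have -> : - k = - k - 1 + 1 by lia.
    by apply/closeS; split.
  by rewrite (rho_val p1 b_gt0 sigma_gt0 s_gt0 hv) subrK.
rewrite integral_cst /=; last by apply: measurableD; exact: mB.
rewrite measureD /=; first last.
- by rewrite (leb_real_of_ball R p1) ltry.
- exact: mB.
- exact: mB.
by rewrite (setIidr sub) !(leb_real_of_ball R p1) -EFinB -EFinM mulrC.
Qed.

(* The difference of both sides does not depend on [k] by [hit_shell] and
   tends to [0] as [k] tends to [-oo]. *)
Lemma hit_near k (y z : Qp p) : ball k y z ->
  hit s (ball k y) z = (p%:R ^ k * mass s (pball (- k)))%:E.
Proof.
move=> /ball_eq <- //; pose m := mass s `[0, +oo[.
pose D k := fine (hit s (ball k z) z) - p%:R ^ k * mass s (pball (- k)).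
have m0 : 0 <= m by exact: mass_ge0.
have DS j : D (j + 1) = D j.
  rewrite /D hit_shell fineD ?hit_ball_fin //=.
  have := mass_pballS p1 b_gt0 sigma_gt0 s_gt0 (- j - 1); rewrite subrK => ->.
  have e1 : (p%:R : R) ^ (j + 1) = p%:R * p%:R ^ j by rewrite expfzDr // expr1z mulrC.
  have e2 : (p%:R : R) ^ (- j - 1) = (p%:R ^ j)^-1 * p%:R^-1.
    by rewrite expfzDr // invr_expz.
  have e3 : (p%:R : R) ^ (- j) = (p%:R ^ j)^-1 by rewrite invr_expz.
  have e4 : - (j + 1) = - j - 1 by rewrite opprD.
  have h := lt0r_neq0 (pX_gt0 j).
  rewrite e1 e2 e3 e4; move: ((p%:R : R) ^ j) h => q h.
  by field; rewrite h pR_neq0.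
have Dbound j : `|D j| <= p%:R ^ j * m.
  have h1 : fine (hit s (ball j z) z) <= p%:R ^ j * m.
    by rewrite -lee_fin fineK ?hit_ball_fin // hit_ball_le.
  have h2 : p%:R ^ j * mass s (pball (- j)) <= p%:R ^ j * m.
    by rewrite ler_pM2l // mass_pball_le_total.
  have h3 : 0 <= fine (hit s (ball j z) z) by rewrite fine_ge0 ?hit_ge0.
  have h4 : 0 <= p%:R ^ j * mass s (pball (- j)).
    by rewrite mulr_ge0 ?mass_ge0 // ltW.
  by rewrite /D ler_norml; apply/andP; split; lra.
have Dn (n : nat) : D k = D (k - n%:Z).
  elim: n => [|n ->]; first by rewrite subr0.
  by rewrite -[in RHS]DS; congr D; lia.
suff : D k = 0 by move/eqP; rewrite subr_eq0 => /eqP <-; rewrite fineK ?hit_ball_fin.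
apply/eqP; apply: contraT => Dk0; have Dk : 0 < `|D k| by rewrite normr_gt0.
have := upper_nthrootP (leqnn (Num.Def.archi_bound ((p%:R ^ k * m) / `|D k|))).
set N := Num.Def.archi_bound _ => hN.
have : p%:R ^ k * m / `|D k| < (p%:R : R) ^ N%:Z.
  by apply: lt_le_trans hN _; rewrite lerXn2r ?nnegrE ?ler_nat.
rewrite ltr_pdivrMr // => h; have := Dbound (k - N%:Z); rewrite -Dn.
rewrite expfzDr // -invr_expz mulrAC ler_pdivlMr // mulrC => h'.
by have := lt_le_trans h h'; rewrite ltxx.
Qed.

End PositiveTime.
End BallProbabilities.

(** * Uniform distribution after a return to the ball *)

Section FiniteDimensional.
Variables (p : nat) (R : realType) (b sigma : R) (a : int).
Hypotheses (p1 : (1 < p)%N) (b_gt0 : 0 < b) (sigma_gt0 : 0 < sigma).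
Let pR_gt0 : 0 < (p%:R : R). Proof. by rewrite ltr0n ltnW. Qed.
Let pX_gt0 (n : int) : 0 < (p%:R : R) ^ n. Proof. exact: exprz_gt0. Qed.
Local Notation xi := (@Qp_of_real p R).
Local Notation leb := (@lebesgue_measure R).
Local Notation ball := (Qp_ball R).
Local Notation realof := (@real_of p R).
Local Notation rho := (rho b sigma).
Local Notation mass := (@mass p R b sigma).
Local Notation pball := (@pball p R).
Local Notation hitp := (@hit p R b sigma).
Local Notation fdd := (@fdd_integral p R b sigma).
Local Notation Ba := (ball a (Qp0 p)).

(* Probability of being in [Ba] a time [s] after being in [Ba]; see [hit_Ba]. *)
Definition stay1 (s : R) : R := p%:R ^ a * mass s (pball (- a)).

(** No position occurs among the arguments: [stay1] is the same from every point of [Ba], so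
    successive stays multiply like independent steps. *)
Fixpoint stay (s0 : R) (ts : seq R) : R :=
  if ts is t :: ts' then stay1 (t - s0) * stay t ts' else 1.

Definition inBa (ts : seq R) : seq (R * set (Qp p)) := [seq (t, Ba) | t <- ts].

Lemma stay1E s : stay1 s = p%:R ^ a * mass s (pball (- a)).
Proof. by []. Qed.

Lemma stay1_ge0 s : 0 <= stay1 s.
Proof. by rewrite mulr_ge0 ?mass_ge0 // ltW. Qed.

Lemma stay_ge0 s0 ts : 0 <= stay s0 ts.
Proof. by elim: ts s0 => //= t ts ih s0; rewrite mulr_ge0 // stay1_ge0. Qed.

Lemma hit_Ba s z : 0 < s -> Ba z -> hitp s Ba z = (stay1 s)%:E.
Proof.
move=> s0 hz; rewrite -(ball_eq p1 hz).
exact: (hit_near p1 b_gt0 sigma_gt0 s0 (ball_center R p1 a z)).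
Qed.

Lemma fdd_cons s0 z t U l : measurable (realof U) ->
  fdd s0 z ((t, U) :: l) = (\int[leb]_(u in realof U)
    ((rho (t - s0) (Qp_sub (xi u) z))%:E * fdd t (xi u) l))%E.
Proof.
move=> mU /=.
exact: (@haar_integral_indic p R U (fun x => rho (t - s0) (Qp_sub x z)) (fun x => fdd t x l)).
Qed.

Lemma measurable_rho_subE s z (D : set R) : 0 < s -> D `<=` `[0, +oo[ ->
  measurable_fun D (fun u => (rho s (Qp_sub (xi u) z))%:E).
Proof. by move=> s0 Dsub; apply/measurable_EFinP; exact: measurable_rho_sub. Qed.

(** The form in which the Markov property enters: an inner integral that is constant on [U] can be
    pulled out, and only the kernel remains to be measured and integrated. *)
Lemma fdd_const s0 z t U l (C : \bar R) : measurable (realof U) -> s0 < t ->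
  (0 <= C)%E -> (forall x, U x -> fdd t x l = C) ->
  fdd s0 z ((t, U) :: l) = (hitp (t - s0) U z * C)%E.
Proof.
move=> mU st C0 hC; rewrite fdd_cons // muleC /hit.
have ts0 : 0 < t - s0 by rewrite subr_gt0.
rewrite -ge0_integralZl //; first last.
- by move=> u _; rewrite lee_fin rho_ge0.
- by apply: measurable_rho_subE => //; exact: real_of_sub.
by apply: eq_integral => u /set_mem [_ Uu]; rewrite hC // muleC.
Qed.

Local Opaque hit.

Lemma measurable_Ba : measurable (realof Ba).
Proof. exact: measurable_real_of_ball. Qed.

(** The tail [l] is kept general, known only through its constant value on [Ba], so that the same
    computation can precede an exit. *)
Lemma fdd_stay s0 ts l z (C : \bar R) : path <%R s0 ts -> Ba z -> (0 <= C)%E ->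
  (forall x, Ba x -> fdd (last s0 ts) x l = C) ->
  fdd s0 z (inBa ts ++ l) = ((stay s0 ts)%:E * C)%E.
Proof.
move=> + + C0; elim: ts s0 z => [|t ts ih] s0 z /=.
  by move=> _ hz ->; rewrite ?mul1e.
move=> /andP[st pts] hz hC; rewrite EFinM -muleA.
rewrite -[RHS](_ : (hitp (t - s0) Ba z * ((stay t ts)%:E * C))%E = _); last first.
  by rewrite hit_Ba // subr_gt0.
apply: fdd_const => //; first exact: measurable_Ba.
  by rewrite mule_ge0 // lee_fin stay_ge0.
by move=> x hx; exact: ih.
Qed.

Lemma fdd_hit_stay s0 z t ts k y : s0 < t -> path <%R t ts -> k <= a -> Ba y ->
  fdd s0 z ((t, ball k y) :: inBa ts) = (hitp (t - s0) (ball k y) z * (stay t ts)%:E)%E.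
Proof.
move=> st pts ka hy; apply: fdd_const => //.
- exact: measurable_real_of_ball.
- by rewrite lee_fin stay_ge0.
move=> x hx; rewrite -[inBa ts]cats0 -[RHS]mule1.
have e01 : (0 <= 1 :> \bar R)%E by rewrite lee_fin ler01.
apply: (@fdd_stay t ts [::] x 1%E pts (ball_sub_ball p1 ka hy hx) e01).
by move=> ? _.
Qed.

Lemma close_outside x z n : ~ Ba x -> Ba z -> (Qp_close n x z <-> Qp_close n x (Qp0 p)).
Proof.
rewrite !(Qp_ballE R p1) /= => hx hz; have [na|an] := leP n (- a).
  by split=> h i hi; rewrite h // hz //; lia.
have far w : Ba w -> ~ Qp_close n x w.
  rewrite (Qp_ballE R p1) /= => hw h; apply: hx => i hi.
  by rewrite h ?hw //; lia.
by split=> h; exfalso; apply: (far _ _ h); rewrite (Qp_ballE R p1).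
Qed.

(** Both kernels are centred at 0 because from outside [Ba] neither the point left nor the point
    returned to matters; the weight thus depends on times alone. *)
Definition exit_weight (s0 s t : R) (ts : seq R) : \bar R :=
  (\int[leb]_(u in realof (~` Ba)) ((rho (s - s0) (Qp_sub (xi u) (Qp0 p)))%:E *
    ((rho (t - s) (Qp_sub (xi u) (Qp0 p)))%:E * (stay t ts)%:E)))%E.

(* Seen from outside [Ba], all points of [Ba] are at the same distance, so the
   process is uniformly distributed in [Ba] when it has just come back. *)
Lemma fdd_exit s0 z s t ts k y : s0 < s -> s < t -> path <%R t ts -> k <= a ->
  Ba y -> Ba z ->
  fdd s0 z ((s, ~` Ba) :: (t, ball k y) :: inBa ts) =
  ((p%:R ^ k)%:E * exit_weight s0 s t ts)%E.
Proof.
move=> s0s st pts ka hy hz; rewrite fdd_cons; last first.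
  by apply: measurable_real_ofC; exact: measurable_Ba.
have [s0s' st'] : 0 < s - s0 /\ 0 < t - s by rewrite !subr_gt0.
rewrite /exit_weight -ge0_integralZl //; first last.
- by rewrite lee_fin ltW.
- by move=> u _; rewrite !mule_ge0 // lee_fin ?rho_ge0 ?stay_ge0.
- apply: emeasurable_funM; last apply: emeasurable_funM.
  + by apply: measurable_rho_subE => //; exact: real_of_sub.
  + by apply: measurable_rho_subE => //; exact: real_of_sub.
  + exact: measurable_cst.
- by apply: measurable_real_ofC; exact: measurable_Ba.
apply: eq_integral => u /set_mem [u0 hu].
have hyu : ~ ball k y (xi u) by move=> h; apply: hu; exact: (ball_sub_ball p1 ka hy).
rewrite (fdd_hit_stay _ st pts ka hy) (hit_far p1 b_gt0 sigma_gt0 st' hyu).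
have shuffle (A A' B B' c d : R) : A = A' -> B = B' ->
    (A%:E * ((c * B)%:E * d%:E) = c%:E * (A'%:E * (B'%:E * d%:E)))%E.
  by move=> -> ->; rewrite -!EFinM; congr (_%:E); ring.
apply: shuffle.
  by apply: (rho_sub_radial p1 b_gt0 sigma_gt0 s0s') => n; exact: close_outside.
apply: (rho_sub_radial p1 b_gt0 sigma_gt0 st') => n.
rewrite -(close_outside n hu hy).
by split=> h i hi; rewrite h.
Qed.

End FiniteDimensional.

(** * Events of the process at finitely many times *)

Section Process.
Variables (p : nat) (R : realType) (b sigma : R) (a : int).
Hypotheses (p1 : (1 < p)%N) (b_gt0 : 0 < b) (sigma_gt0 : 0 < sigma).
Let pR_gt0 : 0 < (p%:R : R). Proof. by rewrite ltr0n ltnW. Qed.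
Let pX_gt0 (n : int) : 0 < (p%:R : R) ^ n. Proof. exact: exprz_gt0. Qed.
Local Notation ball := (Qp_ball R).
Local Notation Ba := (ball a (Qp0 p)).
Local Notation hitp := (@hit p R b sigma).
Local Notation stay := (stay p b sigma a).
Local Notation stay1 := (stay1 p b sigma a).
Local Notation inBa := (@inBa p R a).

(** Stated with [nth] so as to be convertible with the event in the assumption on the
    finite-dimensional distributions. *)
Definition evt (l : seq (R * set (Qp p))) : set (Dmeas p R) :=
  [set w : Dmeas p R | forall i, (i < size l)%N ->
     (nth (0, setT) l i).2 (Xt (nth (0, setT) l i).1 w)].

Definition at_in (t : R) (U : set (Qp p)) : set (Dmeas p R) := [set w | U (Xt t w)].

Lemma evt_nil : evt [::] = setT.
Proof. by apply/seteqP; split=> w //= _ i; rewrite ltn0. Qed.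

Lemma evt_cons t U l : evt ((t, U) :: l) = at_in t U `&` evt l.
Proof.
apply/seteqP; split=> w /=; rewrite /evt /at_in /=.
  by move=> h; split=> [|i hi]; [exact: (h 0%N)|exact: (h i.+1)].
by move=> [h1 h2] [|i] hi /=; [exact: h1|exact: h2].
Qed.

Lemma evt_cat l l' : evt (l ++ l') = evt l `&` evt l'.
Proof.
elim: l => [|[t U] l ih]; first by rewrite evt_nil setTI.
by rewrite cat_cons !evt_cons ih setIA.
Qed.

Definition borel (l : seq (R * set (Qp p))) :=
  forall i, (i < size l)%N -> Qp_borel R (nth (0, setT) l i).2.

Lemma borel_cons t U l : Qp_borel R U -> borel l -> borel ((t, U) :: l).
Proof. by move=> hU hl [|i] hi; [exact: hU|exact: hl]. Qed.

Lemma borel_cat l l' : borel l -> borel l' -> borel (l ++ l').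
Proof.
move=> h h' i hi; rewrite nth_cat; case: ltnP => h2; first exact: h.
by apply: h'; rewrite ltn_subLR // -size_cat.
Qed.

Lemma borel_ball k (y : Qp p) : Qp_borel R (ball k y).
Proof. by apply: sub_sigma_algebra; exists k, y. Qed.

Lemma borelC_Ba : Qp_borel R (~` Ba).
Proof. by rewrite -setTD; exact: (sigma_algebraCD (borel_ball a (Qp0 p))). Qed.

Lemma borel_inBa ts : borel (inBa ts).
Proof. by elim: ts => [|t ts ih] //; apply: borel_cons => //; exact: borel_ball. Qed.

Lemma measurable_at_in t U : Qp_borel R U -> measurable (at_in t U).
Proof. by move=> hU; apply: sub_sigma_algebra; exists t, U. Qed.

Lemma measurable_evt l : borel l -> measurable (evt l).
Proof.
elim: l => [|[t U] l ih] hl; first by rewrite evt_nil; exact: measurableT.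
rewrite evt_cons; apply: measurableI.
  by apply: measurable_at_in; exact: (hl 0%N).
by apply: ih => i hi; exact: (hl i.+1).
Qed.

Variable P : probability (Dmeas p R) R.
Hypothesis hfdd : forall l : seq (R * set (Qp p)),
  path <%R 0 [seq z.1 | z <- l] -> borel l ->
  P (evt l) = fdd_integral b sigma 0 (Qp0 p) l.

Definition prob (A : set (Dmeas p R)) : R := fine (P A).

Lemma prob_split l l' s : borel (l ++ l') ->
  prob (evt (l ++ l')) = prob (evt (l ++ (s, Ba) :: l')) +
                         prob (evt (l ++ (s, ~` Ba) :: l')).
Proof.
move=> hl; have mB : measurable (at_in s Ba).
  by apply: measurable_at_in; exact: borel_ball.
have mE := measurable_evt hl.
have E U : evt (l ++ (s, U) :: l') = evt (l ++ l') `&` at_in s U.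
  by rewrite !evt_cat evt_cons setICA setIC.
have fI U : Qp_borel R U -> P (evt (l ++ l') `&` at_in s U) \is a fin_num.
  move=> hU; apply: fin_num_measure; apply: measurableI => //.
  exact: measurable_at_in.
rewrite !E /prob -fineD; last 2 first.
- by apply: fI; exact: borel_ball.
- by apply: fI; exact: borelC_Ba.
congr fine; rewrite (measureDI P mE mB) addeC; congr (_ + _)%E.
Qed.

Lemma inBa_times ts : [seq z.1 | z <- inBa ts] = ts.
Proof. by rewrite -map_comp map_id. Qed.

Lemma inBa_cat ts ts' : inBa (ts ++ ts') = inBa ts ++ inBa ts'.
Proof. exact: map_cat. Qed.

Lemma Qp0_Ba : Ba (Qp0 p).
Proof. exact: ball_center. Qed.

(** [fine] sends both infinities to 0, so this also applies to [exit_weight], for which no bound is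
    established. *)
Lemma fineMl (r : R) (x : \bar R) : 0 <= r -> fine (r%:E * x)%E = r * fine x.
Proof.
rewrite le_eqVlt => /predU1P[<-|r0]; first by rewrite mul0e mul0r.
case: x => [x| |]; first by [].
- by rewrite mulry gtr0_sg // mul1e /= mulr0.
- by rewrite mulrNy gtr0_sg // mul1e /= mulr0.
Qed.

Lemma prob_stay ts ts' t k y : path <%R 0 (ts ++ t :: ts') -> k <= a -> Ba y ->
  prob (evt (inBa ts ++ (t, ball k y) :: inBa ts')) =
  fine (fdd_integral b sigma 0 (Qp0 p) (inBa ts ++ (t, ball k y) :: inBa ts')).
Proof.
move=> pts ka hy; rewrite /prob hfdd //.
  by rewrite map_cat /= !inBa_times.
apply: borel_cat; first exact: borel_inBa.
by apply: borel_cons; [exact: borel_ball|exact: borel_inBa].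
Qed.

Lemma prob_exit ts s t ts' k y : path <%R 0 (ts ++ s :: t :: ts') ->
  k <= a -> Ba y ->
  prob (evt (inBa ts ++ (s, ~` Ba) :: (t, ball k y) :: inBa ts')) =
  stay 0 ts * (p%:R ^ k * fine (exit_weight p b sigma a (last 0 ts) s t ts')).
Proof.
move=> pts ka hy; have := pts; rewrite cat_path /= => /and4P[p1' h1 h2 h3].
rewrite /prob hfdd; first last.
- apply: borel_cat; first exact: borel_inBa.
  apply: borel_cons; first exact: borelC_Ba.
  by apply: borel_cons; [exact: borel_ball|exact: borel_inBa].
- by rewrite map_cat /= !inBa_times.
rewrite (fdd_stay p1 b_gt0 sigma_gt0 (C := ((p%:R ^ k)%:E *
    exit_weight p b sigma a (last 0%R ts) s t ts')%E) p1' Qp0_Ba).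
- by rewrite !fineMl ?stay_ge0 // ltW.
- rewrite mule_ge0 ?lee_fin ?(ltW (pX_gt0 _)) //.
  apply: integral_ge0 => u _; rewrite !mule_ge0 // lee_fin ?stay_ge0 //.
    by apply: rho_ge0 => //; rewrite subr_gt0.
  by apply: rho_ge0 => //; rewrite subr_gt0.
- by move=> x hx; exact: fdd_exit.
Qed.

(* Induction on the times [ts], splitting according to the first exit: each
   exit contributes an amount proportional to the measure of the target ball. *)
Lemma prob_uniform ts0 ts t ts' k y : path <%R 0 (ts0 ++ ts ++ t :: ts') ->
  k <= a -> Ba y ->
  prob (evt (inBa ts0 ++ (t, ball k y) :: inBa ts')) -
  prob (evt (inBa ts0 ++ inBa ts ++ (t, ball k y) :: inBa ts')) =
  p%:R ^ (k - a) * (prob (evt (inBa ts0 ++ (t, Ba) :: inBa ts')) -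
  prob (evt (inBa ts0 ++ inBa ts ++ (t, Ba) :: inBa ts'))).
Proof.
move=> + ka hy; elim: ts ts0 => [|s ts ih] ts0 pts.
  by rewrite /= !subrr mulr0.
have hb k' y' : borel (inBa ts0 ++ (t, ball k' y') :: inBa ts').
  apply: borel_cat; first exact: borel_inBa.
  by apply: borel_cons; [exact: borel_ball|exact: borel_inBa].
have pts' : path <%R 0 ((ts0 ++ [:: s]) ++ ts ++ t :: ts').
  by rewrite -catA.
have pst : path <%R 0 (ts0 ++ s :: t :: ts').
  apply: (subseq_path lt_trans _ pts); rewrite cat_subseq //= eqxx.
  by rewrite suffix_subseq // suffix_suffix.
have := ih _ pts'; rewrite !inBa_cat -!catA /= => ih'.
(* Split at the first remaining time [s]. Paths in [Ba] at [s] fall under the induction hypothesis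
   with [s] moved to [ts0]; those outside are handled by [prob_exit], in the ratio p^(k-a) for the
   two targets. *)
rewrite (prob_split (l := inBa ts0) s (hb k y)) (prob_split (l := inBa ts0) s (hb a (Qp0 p))).
rewrite (prob_exit pst ka hy) (prob_exit pst (lexx a) Qp0_Ba).
have pk : (p%:R : R) ^ k = p%:R ^ (k - a) * p%:R ^ a.
  by rewrite -expfzDr ?subrK // gt_eqF.
rewrite pk; move: ih'; rewrite /inBa /=.
move: (prob _) (prob _) (prob _) (prob _) (fine _) (stay _ _) => A B C D E F.
by move=> /eqP; rewrite subr_eq => /eqP ->; ring.
Qed.

Lemma prob_at_stay t ts k y : 0 < t -> path <%R t ts -> k <= a -> Ba y ->
  prob (evt ((t, ball k y) :: inBa ts)) =
  fine (hitp t (ball k y) (Qp0 p)) * stay t ts.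
Proof.
move=> t0 pts ka hy; have pts0 : path <%R 0 ([::] ++ t :: ts) by rewrite /= t0.
rewrite -[X in evt X]cat0s (prob_stay pts0 ka hy) cat0s.
rewrite (fdd_hit_stay p1 b_gt0 sigma_gt0 _ t0 pts ka hy) subr0.
by rewrite muleC fineMl ?stay_ge0 // mulrC.
Qed.

Lemma prob_all_stay ts : path <%R 0 ts -> prob (evt (inBa ts)) = stay 0 ts.
Proof.
move=> pts; rewrite /prob hfdd; [|by rewrite inBa_times|exact: borel_inBa].
have e01 : (0 <= 1 :> \bar R)%E by rewrite lee_fin ler01.
rewrite -[inBa ts]cats0.
by rewrite (fdd_stay p1 b_gt0 sigma_gt0 (C := 1%E) pts Qp0_Ba e01) // mule1.
Qed.

Lemma stay_cat s0 ts ts' : stay s0 (ts ++ ts') = stay s0 ts * stay (last s0 ts) ts'.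
Proof. by elim: ts s0 => [|t ts ih] s0 /=; rewrite ?mul1r // ih mulrA. Qed.

(** By uniformity, paths that had left [Ba] at a grid time carry into the small ball the share
    p^(k-a) of their total [stay1 t - stay 0 (ts ++ [:: t])]. They are subtracted from all paths
    reaching that ball, and the times after [t] only contribute a factor. *)
Lemma prob_grid ts t ts' k y : path <%R 0 (ts ++ t :: ts') -> k <= a -> Ba y ->
  prob (evt (inBa ts ++ (t, ball k y) :: inBa ts')) =
  stay t ts' * (fine (hitp t (ball k y) (Qp0 p)) -
    p%:R ^ (k - a) * (stay1 t - stay 0 (ts ++ [:: t]))).
Proof.
move=> pts ka hy; have := pts; rewrite cat_path /= => /and3P[h1 h2 h3].
have t0 : 0 < t.
  have : path <%R 0 [:: t].
    apply: (subseq_path lt_trans _ pts).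
    by rewrite -[[:: t]]cat0s cat_subseq ?sub0seq //= eqxx sub0seq.
  by rewrite /= andbT.
have := prob_uniform (ts0 := [::]) pts ka hy; rewrite /= => /eqP.
rewrite subr_eq addrC -subr_eq => /eqP <-.
rewrite (prob_at_stay t0 h3 ka hy) (prob_at_stay t0 h3 (lexx a) Qp0_Ba).
rewrite (hit_Ba p1 b_gt0 sigma_gt0 t0 Qp0_Ba) /=.
have -> : prob (evt (inBa ts ++ (t, Ba) :: inBa ts')) =
    stay 0 (ts ++ [:: t]) * stay t ts'.
  have -> : inBa ts ++ (t, Ba) :: inBa ts' = inBa (ts ++ t :: ts').
    by rewrite inBa_cat.
  by rewrite prob_all_stay // -cat1s catA stay_cat last_cat.
by ring.
Qed.

End Process.

(** * The inequality between staying probabilities *)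

Section StayBounds.
Variables (p : nat) (R : realType) (b sigma : R) (a : int).
Hypotheses (p1 : (1 < p)%N) (b_gt0 : 0 < b) (sigma_gt0 : 0 < sigma).
Let pR_gt0 : 0 < (p%:R : R). Proof. by rewrite ltr0n ltnW. Qed.
Let pR_gt1 : 1 < (p%:R : R). Proof. by rewrite ltr1n. Qed.
Let pX_gt0 (n : int) : 0 < (p%:R : R) ^ n. Proof. exact: exprz_gt0. Qed.
Local Notation xi := (@Qp_of_real p R).
Local Notation leb := (@lebesgue_measure R).
Local Notation pball := (@pball p R).
Local Notation stay := (stay p b sigma a).
Local Notation stay1 := (stay1 p b sigma a).

Lemma expR_chord (u v : R) : 0 <= v <= 1 -> expR (u * v) <= 1 - v + v * expR u.
Proof.
(* The tangent of exp at [u * v], evaluated at 0 and at [u], is averaged with the weights [1 - v]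
   and [v]. *)
move=> /andP[v0 v1]; have h1 := expR_ge1Dx (- (u * v)).
have h2 := expR_ge1Dx (u - u * v); have z0 := expR_gt0 (u * v).
have e1 : expR (u * v) * (1 - u * v) <= 1.
  rewrite -[X in _ <= X](@expR0 R) -(subrr (u * v)) expRD ler_pM2l //; exact: h1.
have e2 : expR (u * v) * (1 + (u - u * v)) <= expR u.
  have -> : expR u = expR (u * v) * expR (u - u * v) by rewrite -expRD addrC subrK.
  by rewrite ler_pM2l.
have : (1 - v) * (expR (u * v) * (1 - u * v)) + v * (expR (u * v) * (1 + (u - u * v)))
    <= (1 - v) * 1 + v * expR u.
  by apply: lerD; apply: ler_wpM2l => //; rewrite subr_ge0.
by rewrite mulr1; move: (expR (u * v)) (expR u) => A B; lra.
Qed.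

Definition radius : R := (p%:R ^ (- a)) `^ b.
Definition jump (u : R) : R := Qp_abs R (xi u) `^ b.
(** [stay1 s] is the mean of exp(- sigma s jump) over the same ball, so [sigma * mean_jump] is its
    rate of decay at s = 0. *)
Definition mean_jump : R := p%:R ^ a * (\int[leb]_(u in pball (- a)) jump u).

Lemma radius_gt0 : 0 < radius. Proof. exact: powR_gt0. Qed.

Lemma jump_itv u : pball (- a) u -> 0 <= jump u <= radius.
Proof.
rewrite in_pball => /andP[u0 ua]; rewrite powR_ge0 /=.
rewrite ge0_ler_powR ?nnegrE ?(ltW b_gt0) ?Qp_abs_ge0 ?(ltW (pX_gt0 _)) //.
exact/(Qp_abs_xi_le p1 _ u0).
Qed.

Lemma measurable_jump : measurable_fun (pball (- a)) jump.
Proof.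
have mj : measurable_fun (`[0, +oo[ : set R) jump.
  apply: (@measurable_radial p R p1 _ _ (Qp0 p) (fun y => Qp_abs R y `^ b)).
  by move=> x x' h; rewrite (radial_Qp_abs p1 b_gt0 sigma_gt0 h).
by apply: measurable_funS mj => //; exact: pball_sub.
Qed.

Lemma leb_pball_fin : (leb (pball (- a)) < +oo)%E.
Proof. by rewrite (leb_pball R p1) ltry. Qed.

Lemma integrable_jump : leb.-integrable (pball (- a)) (EFin \o jump).
Proof.
apply: measurable_bounded_integrable.
- exact: measurable_pball.
- exact: leb_pball_fin.
- exact: measurable_jump.
exists radius; split; first exact: num_real.
move=> M hM u /= hu; have /andP[h1 h2] := jump_itv hu.
by rewrite ger0_norm // (le_trans h2) // ltW.
Qed.

Lemma integrable_cst_pball c : leb.-integrable (pball (- a)) (EFin \o cst c).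
Proof.
apply: measurable_bounded_integrable.
- exact: measurable_pball.
- exact: leb_pball_fin.
- exact: measurable_cst.
by exists `|c|; split; [exact: num_real|move=> M hM u /= _; exact: ltW].
Qed.

Lemma integrable_affine c d :
  leb.-integrable (pball (- a)) (EFin \o (fun u => c + d * jump u)).
Proof.
have mB : measurable (pball (- a)) by exact: measurable_pball.
apply: (@eq_integrable _ _ _ leb _ mB ((EFin \o cst c) \+ (fun u => d%:E * (EFin \o jump) u))%E).
  by move=> u _.
apply: integrableD => //; first exact: integrable_cst_pball.
by apply: integrableZl => //; exact: integrable_jump.
Qed.

Lemma mean_affine c d :
  p%:R ^ a * (\int[leb]_(u in pball (- a)) (c + d * jump u)) = c + d * mean_jump.
Proof.
have mB : measurable (pball (- a)) by exact: measurable_pball.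
rewrite RintegralD //; [|exact: integrable_cst_pball|]; last first.
  apply: (@eq_integrable _ _ _ leb _ mB (fun u => d%:E * (EFin \o jump) u)%E).
    by move=> u _.
  by apply: integrableZl => //; exact: integrable_jump.
rewrite Rintegral_cst // RintegralZl //; last exact: integrable_jump.
rewrite (_ : fine _ = p%:R ^ (- a)); last by rewrite /= (leb_pball R p1).
rewrite /mean_jump mulrDr mulrCA -expfzDr ?gt_eqF //.
by rewrite subrr expr0z mulr1 mulrCA.
Qed.

Lemma integrable_phi_pball s : 0 < s ->
  leb.-integrable (pball (- a)) (EFin \o phi p b sigma s).
Proof.
move=> s0; apply: integrableS (integrable_phi p1 b_gt0 sigma_gt0 s0) => //.
  exact: measurable_pball.
exact: pball_sub.
Qed.

Lemma mean_jump_itv : 0 <= mean_jump <= radius.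
Proof.
have mB : measurable (pball (- a)) by exact: measurable_pball.
apply/andP; split.
  by rewrite mulr_ge0 ?(ltW (pX_gt0 _)) // Rintegral_ge0 // => u /jump_itv/andP[].
have -> : radius = p%:R ^ a * (\int[leb]_(u in pball (- a)) (radius + 0 * jump u)).
  by rewrite mean_affine mul0r addr0.
rewrite ler_pM2l // le_Rintegral //; first exact: integrable_jump.
  exact: integrable_affine.
by move=> u /jump_itv/andP[_]; rewrite mul0r addr0.
Qed.

(** Affine bounds of the exponential on [0, radius] pass to the mean, where [v] becomes [mean_jump].
    A tangent then gives Jensen's inequality, and a chord, through [stay1_le], a bound in the other
    direction. *)
Lemma stay1_ge c d s : 0 < s ->
  (forall v, 0 <= v <= radius -> c + d * v <= expR (- (sigma * s * v))) ->
  c + d * mean_jump <= stay1 s.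
Proof.
have mB : measurable (pball (- a)) by exact: measurable_pball.
move=> s0 h; rewrite -mean_affine stay1E massE ler_pM2l //.
apply: (@le_Rintegral _ _ R leb) => //.
- exact: integrable_affine.
- exact: integrable_phi_pball.
by move=> u /jump_itv/h.
Qed.

Lemma stay1_le c d s : 0 < s ->
  (forall v, 0 <= v <= radius -> expR (- (sigma * s * v)) <= c + d * v) ->
  stay1 s <= c + d * mean_jump.
Proof.
have mB : measurable (pball (- a)) by exact: measurable_pball.
move=> s0 h; rewrite -mean_affine stay1E massE ler_pM2l //.
apply: (@le_Rintegral _ _ R leb) => //.
- exact: integrable_phi_pball.
- exact: integrable_affine.
by move=> u /jump_itv/h.
Qed.

(* Jensen's inequality, via the tangent line of [exp] at the mean. *)
Lemma stay1_ge_exp s : 0 < s -> expR (- (sigma * mean_jump * s)) <= stay1 s.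
Proof.
move=> s0; set m := sigma * mean_jump * s.
have -> : expR (- m) = expR (- m) * (1 + m) + (- (expR (- m) * (sigma * s))) * mean_jump.
  by rewrite {3}/m; move: (expR _) => e; ring.
apply: stay1_ge => // v _.
have h := expR_ge1Dx (m - sigma * s * v).
have -> : - (sigma * s * v) = - m + (m - sigma * s * v) by ring.
rewrite expRD; have -> : expR (- m) * (1 + m) + - (expR (- m) * (sigma * s)) * v =
  expR (- m) * (1 + (m - sigma * s * v)) by move: (expR _) => e; ring.
by rewrite ler_pM2l // expR_gt0.
Qed.

Lemma stay1_le_chord s : 0 < s ->
  stay1 s <= 1 - mean_jump / radius * (1 - expR (- (sigma * s * radius))).
Proof.
move=> s0; set E := expR _.
have -> : 1 - mean_jump / radius * (1 - E) = 1 + (- ((1 - E) / radius)) * mean_jump by ring.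
apply: stay1_le => // v /andP[v0 v1].
have hv : 0 <= v / radius <= 1.
  by rewrite divr_ge0 ?(ltW radius_gt0) //= ler_pdivrMr ?radius_gt0 // mul1r.
have := expR_chord (- (sigma * s * radius)) hv; rewrite -/E.
have -> : - (sigma * s * radius) * (v / radius) = - (sigma * s * v).
  by field; rewrite gt_eqF // radius_gt0.
by move=> h; apply: (le_trans h); rewrite le_eqVlt; apply/orP; left; apply/eqP; ring.
Qed.

(** The exponents of the single steps add up to the elapsed time, so the bound is the same for all
    grids with the same ends and survives refinement. *)
Lemma stay_ge_exp s0 ts : path <%R s0 ts ->
  expR (- (sigma * mean_jump * (last s0 ts - s0))) <= stay s0 ts.
Proof.
elim: ts s0 => [|t ts ih] s0 /=; first by rewrite subrr mulr0 oppr0 expR0.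
move=> /andP[st pts].
have -> : - (sigma * mean_jump * (last t ts - s0)) =
  - (sigma * mean_jump * (t - s0)) + - (sigma * mean_jump * (last t ts - t)) by ring.
rewrite expRD; apply: ler_pM; [exact: expR_ge0|exact: expR_ge0| |exact: ih].
by apply: stay1_ge_exp; rewrite subr_gt0.
Qed.

(* With [c] the probability of staying in
   the ball up to time [t], [stay1 t - shell t (1 - a)] is the smallest normalised
   density on the ball.  Bound [stay1 t] above by the chord of [exp] and use
   the hypothesis on [c] together with the chord of [exp] at [m * u]. *)
Lemma bridge_inequality (t c r : R) : 0 < t ->
  expR (- (sigma * mean_jump * t)) <= c <= 1 ->
  stay1 t - shell p b sigma t (1 - a) <= r ->
  stay1 t - c <= r * (1 - c).
Proof.
have pa1 : (p%:R : R) ^ (- a) <= p%:R ^ (1 - a) by rewrite ler_eXz2l //; lia.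
move=> t0 /andP[c0 c1] hr.
set u := sigma * t * radius; set m := mean_jump / radius.
have /andP[m0 m1] := mean_jump_itv; have r0 := radius_gt0.
have hm : 0 <= m <= 1.
  by rewrite divr_ge0 ?(ltW r0) //= ler_pdivrMr // mul1r.
have um : sigma * mean_jump * t = u * m by rewrite /u /m; field; rewrite gt_eqF.
have hs := stay1_le_chord t0; rewrite -/u -/m in hs.
have he : shell p b sigma t (1 - a) <= expR (- u).
  rewrite ler_expR lerN2 /u ler_pM2l ?mulr_gt0 //.
  rewrite ge0_ler_powR ?nnegrE ?(ltW b_gt0) ?(ltW (pX_gt0 _)) //.
have hch := expR_chord u hm; rewrite um in c0.
have E1 : expR (- u) * expR u = 1 by rewrite -expRD addNr expR0.
have E2 : expR (- (u * m)) * expR (u * m) = 1 by rewrite -expRD addNr expR0.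
have e0 := expR_gt0 (- u); have f0 := expR_gt0 (u * m).
have g0 := expR_gt0 (- (u * m)).
have k1 : 1 <= c * expR (u * m) by rewrite -E2 ler_pM2r.
have c_gt0 : 0 < c by apply: lt_le_trans c0.
have k2 : 1 - c <= c * (m * (expR u - 1)).
  have : c * expR (u * m) <= c * (1 - m + m * expR u) by rewrite ler_pM2l.
  by move: (expR u) (expR (u * m)) k1 => A B; lra.
(* This is [stay1 t - c <= (stay1 t - expR (- u)) * (1 - c)] rearranged. The factor exp(-u) turns m
   (exp(u) - 1) into m (1 - exp(-u)), which the chord bound [hs] places below [1 - stay1 t]. *)
have k3 : expR (- u) * (1 - c) <= c * (1 - stay1 t).
  have : expR (- u) * (1 - c) <= expR (- u) * (c * (m * (expR u - 1))).
    by rewrite ler_pM2l.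
  have -> : expR (- u) * (c * (m * (expR u - 1))) =
      c * (m * (expR (- u) * expR u - expR (- u))) by ring.
  rewrite E1 => h; apply: (le_trans h); rewrite ler_pM2l //.
  by lra.
have k4 : shell p b sigma t (1 - a) * (1 - c) <= expR (- u) * (1 - c).
  by rewrite ler_wpM2r // subr_ge0.
have k5 : (stay1 t - shell p b sigma t (1 - a)) * (1 - c) <= r * (1 - c).
  by rewrite ler_wpM2r // subr_ge0.
by apply: le_trans k5; move: k3 k4; lra.
Qed.

End StayBounds.

(** * Passage to continuous time *)

Section Grids.
Variables (p : nat) (R : realType) (a : int).
Hypotheses (p1 : (1 < p)%N).
Local Notation ball := (Qp_ball R).
Local Notation Ba := (ball a (Qp0 p)).
Local Notation inBa := (@inBa p R a).
Implicit Types (alpha beta : R).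

Definition stays alpha beta : set (Dmeas p R) :=
  [set w : Dmeas p R | forall s, alpha <= s <= beta -> Ba (Xt s w)].

(** The shift to [j.+1] omits [alpha], from which the times must strictly increase, and makes [beta]
    the last node. Dyadic spacing nests the grids. *)
Definition node alpha beta (m j : nat) : R :=
  alpha + (beta - alpha) * (j.+1%:R / 2 ^+ m).

Definition grid alpha beta (m : nat) : seq R :=
  [seq node alpha beta m j | j <- iota 0 (2 ^ m)].

Lemma evt_inBa ts w : evt (inBa ts) w <-> forall s, s \in ts -> Ba (Xt s w).
Proof.
elim: ts => [|t ts ih]; first by rewrite evt_nil; split.
rewrite /= evt_cons; split=> [[h1 /ih h2] s|h].
  by rewrite in_cons => /predU1P[->//|]; exact: h2.
split; first by apply: h; rewrite mem_head.
by apply/ih => s hs; apply: h; rewrite in_cons hs orbT.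
Qed.

Lemma node_itv alpha beta m j : alpha <= beta -> (j < 2 ^ m)%N ->
  alpha <= node alpha beta m j <= beta.
Proof.
move=> ab jm; have ab0 : 0 <= beta - alpha by rewrite subr_ge0.
have m0 : 0 < 2 ^+ m :> R by rewrite exprn_gt0.
rewrite /node lerDl mulr_ge0 ?divr_ge0 ?(ltW m0) //=.
rewrite -lerBrDl -[leRHS]mulr1 ler_wpM2l // ler_pdivrMr // mul1r.
by rewrite -natrX ler_nat.
Qed.

Lemma grid_subset alpha beta m s : s \in grid alpha beta m -> s \in grid alpha beta m.+1.
Proof.
move=> /mapP[j]; rewrite mem_iota add0n /= => jm ->.
apply/mapP; exists (j.*2.+1).
  by rewrite mem_iota add0n /= expnS mul2n -doubleS leq_double.
rewrite /node -doubleS -mul2n natrM exprS; congr (_ + _ * _).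
by rewrite -mulf_div divff ?mul1r.
Qed.

Lemma node_lt alpha beta m i j : alpha < beta -> (i < j)%N ->
  node alpha beta m i < node alpha beta m j.
Proof.
move=> ab ij; rewrite /node ltrD2l ltr_pM2l ?subr_gt0 // ltr_pM2r ?ltr_nat //.
Qed.

Lemma path_map_iota (f : nat -> R) x k n : (forall i j, (i < j)%N -> f i < f j) ->
  x < f k -> path <%R x [seq f i | i <- iota k n].
Proof.
move=> fi; elim: n x k => //= n ih x k xk; rewrite xk /=; apply: ih; exact: fi.
Qed.

Lemma grid_path alpha beta m : alpha < beta -> path <%R alpha (grid alpha beta m).
Proof.
move=> ab; apply: path_map_iota => [i j|]; first exact: node_lt.
by rewrite /node ltrDl mulr_gt0 ?subr_gt0 // divr_gt0 // exprn_gt0.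
Qed.

Definition grid' alpha beta m := [seq node alpha beta m j | j <- iota 0 (2 ^ m).-1].

Lemma grid_rcons alpha beta m : grid alpha beta m = grid' alpha beta m ++ [:: beta].
Proof.
rewrite /grid /grid'; have m0 : (0 < 2 ^ m)%N by rewrite expn_gt0.
rewrite -{1}(prednK m0) -addn1 iotaD map_cat /= add0n /node prednK //.
by rewrite natrX divff ?mulr1 ?subrKC // expf_neq0.
Qed.

Lemma nonincreasing_grid alpha beta m :
  evt (inBa (grid alpha beta m.+1)) `<=` evt (inBa (grid alpha beta m)).
Proof. by move=> w /evt_inBa h; apply/evt_inBa => s /grid_subset; exact: h. Qed.

Lemma grid_between alpha beta s d : alpha <= s -> s < beta -> 0 < d ->
  exists m, exists2 q, q \in grid alpha beta m & s < q < s + d.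
Proof.
move=> as_ sb d0; have ab : alpha < beta by exact: le_lt_trans sb.
have h0 : 0 < beta - alpha by rewrite subr_gt0.
have [m hm] : exists m, (beta - alpha) / d < 2 ^+ m.
  by exists (Num.Def.archi_bound ((beta - alpha) / d)); exact: upper_nthrootP.
have m0 : 0 < 2 ^+ m :> R by rewrite exprn_gt0.
(* The position of [s] in units of the mesh. Node number [floor z] has position [floor z + 1], which
   is above [z] and at most [z + 1]. *)
pose z := (s - alpha) / (beta - alpha) * 2 ^+ m.
have z0 : 0 <= z by rewrite mulr_ge0 ?(ltW m0) // divr_ge0 ?subr_ge0 // ltW.
have /andP[j1 j2] := truncn_itv z0; set j := Num.truncn z in j1 j2.
have sE : s = alpha + (beta - alpha) * (z / 2 ^+ m).
  rewrite /z mulfK ?gt_eqF // mulrCA divff ?gt_eqF // mulr1.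
  by rewrite subrKC.
have jm : (j < 2 ^ m)%N.
  rewrite -(ltr_nat R) natrX; apply: le_lt_trans j1 _.
  rewrite -[X in _ < X]mul1r ltr_pM2r // ltr_pdivrMr // mul1r.
  by rewrite ltrD2r.
exists m, (node alpha beta m j); first by apply: map_f; rewrite mem_iota.
rewrite /node {1}sE ltrD2l ltr_pM2l // ltr_pM2r ?invr_gt0 // j2 /=.
rewrite {1}sE -addrA ltrD2l.
have : (beta - alpha) / 2 ^+ m < d by rewrite ltr_pdivrMr // mulrC -ltr_pdivrMr.
have : (beta - alpha) * (j.+1%:R / 2 ^+ m) <= (beta - alpha) * ((z + 1) / 2 ^+ m).
  by rewrite ler_wpM2l ?(ltW h0) // ler_wpM2r ?invr_ge0 ?(ltW m0) // -natr1 lerD2r.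
by rewrite [(z + 1) / _]mulrDl mulrDr mul1r; lra.
Qed.

(** By right continuity, some node just after [s < beta] sees the path agree with its value at [s]
    in all digits below [- a], and these decide membership in [Ba]. The end [beta] is itself a
    node. *)
Lemma stays_bigcap alpha beta : 0 <= alpha -> alpha <= beta ->
  \bigcap_m evt (inBa (grid alpha beta m)) = stays alpha beta.
Proof.
move=> a0 ab; apply/seteqP; split=> w; last first.
  move=> h m _; apply/evt_inBa => s /mapP[j]; rewrite mem_iota add0n /= => jm ->.
  by apply: h; exact: node_itv.
move=> h s /andP[as_ sb]; have [_ rc _] := proj2_sig w.
have := sb; rewrite le_eqVlt => /predU1P[->|slt].
  have /evt_inBa := h 0%N I; apply; rewrite grid_rcons mem_cat mem_seq1 eqxx.
  exact: orbT.
have [d d0 hd] := rc s (le_trans a0 as_) (- a).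
have [m [q qm /andP[sq qd]]] := grid_between as_ slt d0.
have /evt_inBa /(_ q qm) := h m I; rewrite !(Qp_ballE R p1) /= => hq i hi.
have := hd q; rewrite (ltW sq) qd => /(_ isT) hc.
by rewrite -(hc i hi); exact: hq.
Qed.

Lemma prob_cvg (P : probability (Dmeas p R) R) (F : nat -> set (Dmeas p R)) :
  (forall m, measurable (F m)) -> (forall m, F m.+1 `<=` F m) ->
  prob P (F m) @[m --> \oo] --> prob P (\bigcap_m F m).
Proof.
move=> mF niF; have mI : measurable (\bigcap_m F m) by exact: bigcap_measurable.
apply: fine_cvg; rewrite fineK ?fin_num_measure //.
apply: (@nonincreasing_cvg_mu _ _ _ P F) => //.
  by rewrite (le_lt_trans (probability_le1 P (mF 0%N))) // ltry.
by apply/nonincreasing_seqP => m; apply/subsetPset; exact: niF.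
Qed.

End Grids.

(** * Staying in the ball and hitting a small ball at time t *)

Section Bridge.
Variables (p : nat) (R : realType) (b sigma : R) (a : int).
Hypotheses (p1 : (1 < p)%N) (b_gt0 : 0 < b) (sigma_gt0 : 0 < sigma).
Let pR_gt0 : 0 < (p%:R : R). Proof. by rewrite ltr0n ltnW. Qed.
Let pR_gt1 : 1 < (p%:R : R). Proof. by rewrite ltr1n. Qed.
Let pX_gt0 (n : int) : 0 < (p%:R : R) ^ n. Proof. exact: exprz_gt0. Qed.
Local Notation ball := (Qp_ball R).
Local Notation Ba := (ball a (Qp0 p)).
Local Notation inBap := (@inBa p R a).
Local Notation hitp := (@hit p R b sigma).
Local Notation stayp := (stay p b sigma a).
Local Notation stay1p := (stay1 p b sigma a).
Local Notation massp := (@mass p R b sigma).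
Local Notation shellp := (@shell p R b sigma).
Local Notation pballp := (@pball p R).

(** By [rho_val] this compares the kernel at norm p^a with the kernel at norm p^(-v): it decreases
    with the norm, so on the ball it is least on the boundary sphere. *)
Lemma rho_val_ge s v : 0 < s -> - a <= v ->
  massp s (pballp (- a)) - p%:R ^ (- a) * shellp s (- a + 1) <=
  massp s (pballp v) - p%:R ^ v * shellp s (v + 1).
Proof.
move=> s0 av; have -> : v = - a + (absz (v + a))%:Z by lia.
elim: (absz _) => [|n]; first by rewrite addr0.
move/le_trans; apply; set k := - a + n%:Z.
have -> : - a + n.+1%:Z = k + 1 by rewrite /k; lia.
rewrite (mass_pballS p1 b_gt0 sigma_gt0 s0).
have h : shellp s (k + 1 + 1) <= shellp s (k + 1).
  by apply: (shell_le p1 b_gt0 sigma_gt0 s0); rewrite lerDl.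
have := ler_wpM2l (ltW (pX_gt0 (k + 1))) h; rewrite mulrBl.
have gen (m c A B : R) : A <= B -> m - c <= m + (B - c) - A by lra.
exact: gen.
Qed.

(* The normalised density [p^a * rho t y] of [X_t] at [y], as a limit over balls. *)
Lemma density_limit t y : 0 < t -> Ba y -> exists r,
  [/\ 0 < r, stay1p t - shellp t (1 - a) <= r &
    (p%:R ^ a * (p%:R ^ n%:Z * fine (hitp t (ball (- n%:Z) y) (Qp0 p))))
      @[n --> \oo] --> r].
Proof.
move=> t0 hy; have hstay : stay1p t - shellp t (1 - a) =
    p%:R ^ a * (massp t (pballp (- a)) - p%:R ^ (- a) * shellp t (- a + 1)).
  rewrite stay1E mulrBr mulrA -expfzDr ?gt_eqF // subrr expr0z mul1r.
  by rewrite [- a + 1]addrC.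
have pXN (n : nat) : (p%:R : R) ^ n%:Z * p%:R ^ (- n%:Z) = 1.
  by rewrite -expfzDr ?gt_eqF // subrr expr0z.
have [y0|[v hv]] := Qp_valP y.
(* For [y = 0] every target ball contains the starting point, so [hit_near] applies for all [n] and
   gives an increasing sequence. *)
- pose u (n : nat) := p%:R ^ a * massp t (pballp n%:Z).
  have -> : (fun n : nat => p%:R ^ a * (p%:R ^ n%:Z *
      fine (hitp t (ball (- n%:Z) y) (Qp0 p)))) = u.
    apply/funext => n; rewrite hit_near //= ?opprK; last first.
      by rewrite (Qp_ballE R p1) /= opprK => i hi; rewrite (y0 _ _ hi).
    by rewrite (mulrA (p%:R ^ n%:Z)) pXN mul1r.
  have umono : nondecreasing_seq u.
    apply/nondecreasing_seqP => n; rewrite /u ler_pM2l //.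
    rewrite -addn1 PoszD (mass_pballS p1 b_gt0 sigma_gt0 t0) lerDl.
    rewrite mulr_ge0 ?(ltW (shell_gt0 _ _ _ _ _)) // subr_ge0.
    by rewrite ler_weXz2l ?(ltW pR_gt1) // lerDl.
  have ucv : cvgn u.
    apply: nondecreasing_is_cvgn => //.
    exists (p%:R ^ a * massp t `[0, +oo[) => _ [n _ <-].
    by rewrite ler_pM2l // (mass_pball_le_total p1 b_gt0 sigma_gt0 t0).
  exists (limn u); split=> //.
    apply: lt_le_trans (nondecreasing_cvgn_le umono ucv 0%N).
    by rewrite mulr_gt0 // (mass_pball_gt0 p1 b_gt0 sigma_gt0 t0).
  (* The term of index |a| suffices: |a| >= - a, so [rho_val_ge] bounds it below. *)
  apply: le_trans (nondecreasing_cvgn_le umono ucv (absz a)).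
  rewrite hstay ler_pM2l //.
  apply: le_trans (rho_val_ge t0 (_ : - a <= (absz a)%:Z)) _; first by lia.
  by rewrite gerBl mulr_ge0 ?(ltW (pX_gt0 _)) // ltW // shell_gt0.
- have av : - a <= v.
    apply/(isval_close _ hv); move: hy; by rewrite (Qp_ballE R p1).
  exists (p%:R ^ a * (massp t (pballp v) - p%:R ^ v * shellp t (v + 1))); split.
  + rewrite mulr_gt0 // -(rho_val p1 b_gt0 sigma_gt0 t0 hv).
    exact: rho_gt0.
  + rewrite hstay (ler_pM2l (pX_gt0 a)); exact: rho_val_ge.
  (* Once n > v the target ball excludes the starting point 0, and by [hit_far] the sequence is
     constant. *)
  apply: cvg_near_cst; exists (absz v).+1; [by []|move=> n /= hn].
  have far : ~ ball (- n%:Z) y (Qp0 p).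
    rewrite (Qp_ballE R p1) /= opprK => h.
    have : Qp_close n%:Z y (Qp0 p) by move=> i hi; rewrite h.
    by move/(isval_close _ hv); lia.
  rewrite (hit_far p1 b_gt0 sigma_gt0 t0 far) /= (mulrA (p%:R ^ n%:Z)) pXN mul1r.
  apply: (congr1 (fun z => p%:R ^ a * z)).
  apply: etrans (rho_val p1 b_gt0 sigma_gt0 t0 hv).
  by apply: (rho_radial p1 b_gt0 sigma_gt0 t0) => m; exact: close_sub.
Qed.

Variable P : probability (Dmeas p R) R.
Hypothesis hfdd : forall l : seq (R * set (Qp p)),
  path <%R 0 [seq z.1 | z <- l] -> borel l ->
  P (evt l) = fdd_integral b sigma 0 (Qp0 p) l.
Variables (t T : R).
Hypotheses (t_gt0 : 0 < t) (tT : t <= T).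

(** For [t = T] all nodes would coincide with [t] and the times would no longer increase strictly,
    hence the empty list. *)
Definition later m := if t < T then grid t T m else [::].

Lemma later_path m : path <%R t (later m).
Proof. by rewrite /later; case: ifP => // h; exact: grid_path. Qed.

Lemma later_bigcap :
  at_in t Ba `&` \bigcap_m evt (inBap (later m)) = stays a t T.
Proof.
rewrite /later; have [h|h] := ltP t T.
  rewrite (stays_bigcap a p1 (ltW t_gt0) tT); apply/seteqP; split=> w; first by case.
  by move=> hw; split=> //; apply: hw; rewrite lexx.
have -> : T = t by apply/le_anti/andP.
apply/seteqP; split=> w.
  by move=> [h1 _] s /le_anti <-.
by move=> hw; split; [apply: hw; rewrite lexx|move=> m _; rewrite /inBa /= evt_nil].
Qed.

Lemma later_nonincreasing m : evt (inBap (later m.+1)) `<=` evt (inBap (later m)).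
Proof. by rewrite /later; case: ifP => // _; exact: nonincreasing_grid. Qed.

Lemma measurable_grid ts : measurable (evt (inBap ts)).
Proof. by apply: measurable_evt; exact: borel_inBa. Qed.

Lemma later_cvg : stayp t (later m) @[m --> \oo] --> prob P (stays a t T) / stay1p t.
Proof.
have s1 : 0 < stay1p t.
  by rewrite stay1E mulr_gt0 // (mass_pball_gt0 p1 b_gt0 sigma_gt0 t_gt0).
have mB := measurable_at_in t (@borel_ball p R a (Qp0 p)).
have -> : (fun m => stayp t (later m)) = fun m =>
    prob P (at_in t Ba `&` evt (inBap (later m))) / stay1p t.
  apply/funext => m /=; rewrite -evt_cons.
  rewrite (prob_at_stay p1 b_gt0 sigma_gt0 hfdd t_gt0 (later_path m) (lexx a) (@Qp0_Ba p R a p1)).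
  rewrite (hit_Ba p1 b_gt0 sigma_gt0 t_gt0 (@Qp0_Ba p R a p1)) /=.
  by rewrite mulrAC divff ?mul1r // gt_eqF.
apply: cvgMl; rewrite -later_bigcap.
have -> : at_in t Ba `&` \bigcap_m evt (inBap (later m)) =
    \bigcap_m (at_in t Ba `&` evt (inBap (later m))).
  apply/seteqP; split=> w; first by move=> [h1 h2] m _; split=> //; exact: h2.
  by move=> h; split; [have [] := h 0%N I|move=> m _; have [] := h m I].
apply: prob_cvg => m; first by apply: measurableI => //; exact: measurable_grid.
by move=> w [h1 /later_nonincreasing h2].
Qed.

Lemma stay_grid_cvg : stayp 0 (grid 0 t m) @[m --> \oo] --> prob P (stays a 0 t).
Proof.
have -> : (fun m => stayp 0 (grid 0 t m)) = fun m => prob P (evt (inBap (grid 0 t m))).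
  by apply/funext => m /=; rewrite (prob_all_stay a p1 b_gt0 sigma_gt0 hfdd) // grid_path.
rewrite -(stays_bigcap a p1 (lexx 0) (ltW t_gt0)).
apply: prob_cvg => m; first exact: measurable_grid.
exact: nonincreasing_grid.
Qed.

Lemma stays_split k y : k <= a -> Ba y ->
  \bigcap_m (evt (inBap (grid 0 t m)) `&` (at_in t (ball k y) `&` evt (inBap (later m)))) =
  stays a 0 T `&` at_in t (ball k y).
Proof.
move=> ka hy; have sub : ball k y `<=` Ba := ball_sub_ball p1 ka hy.
have := stays_bigcap a p1 (lexx 0) (ltW t_gt0) => E1; have E2 := later_bigcap.
apply/seteqP; split=> w.
  move=> h; have hU : at_in t (ball k y) w by have [_ []] := h 0%N I.
  split; last exact: hU.
  move=> s /andP[s0 sT].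
  have [st|ts] := leP s t.
    have : stays a 0 t w by rewrite -E1 => m _; have [] := h m I.
    by apply; rewrite s0.
  have : stays a t T w.
    by rewrite -E2; split; [exact: sub|move=> m _; have [_ []] := h m I].
  by apply; rewrite (ltW ts).
move=> [h hU] m _; split.
  have : stays a 0 t w by move=> s /andP[s0 st]; apply: h; rewrite s0 (le_trans st).
  by rewrite -E1; apply.
split; first exact: hU.
have : stays a t T w.
  by move=> s /andP[ts sT]; apply: h; rewrite sT (le_trans (ltW t_gt0)).
by rewrite -E2 => -[_]; apply.
Qed.

Lemma prob_bridge k y : k <= a -> Ba y ->
  prob P (stays a 0 T `&` at_in t (ball k y)) =
  prob P (stays a t T) / stay1p t *
  (fine (hitp t (ball k y) (Qp0 p)) -
    p%:R ^ (k - a) * (stay1p t - prob P (stays a 0 t))).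
Proof.
move=> ka hy; rewrite -(stays_split ka hy).
have mU := measurable_at_in t (@borel_ball p R k y).
set F := fun m => evt (inBap (grid 0 t m)) `&` (at_in t (ball k y) `&` evt (inBap (later m))).
have hF : prob P (F m) @[m --> \oo] --> prob P (\bigcap_m F m).
  apply: prob_cvg => m.
    apply: measurableI; first exact: measurable_grid.
    by apply: measurableI; [exact: mU|exact: measurable_grid].
  by move=> w [/nonincreasing_grid h1 [h2 /later_nonincreasing h3]].
have FE : (fun m => prob P (F m)) = fun m => stayp t (later m) *
    (fine (hitp t (ball k y) (Qp0 p)) - p%:R ^ (k - a) *
      (stay1p t - stayp 0 (grid 0 t m))).
  apply/funext => m /=.
  have pth : path <%R 0 (grid' 0 t m ++ t :: later m).
    have := grid_path m t_gt0; rewrite grid_rcons !cat_path /= andbT => /andP[-> ->].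
    exact: later_path.
  rewrite [in RHS]grid_rcons -(prob_grid p1 b_gt0 sigma_gt0 hfdd pth ka hy).
  congr (prob P _); rewrite evt_cat evt_cons /F.
  rewrite grid_rcons inBa_cat evt_cat /= evt_cons evt_nil setIT -setIA; congr (_ `&` _).
  (* The grid on [0, t] ends at [t] and asks for [Ba] there, which the smaller ball already
     implies. *)
  rewrite setIA; congr (_ `&` _); apply: setIidr.
  move=> w; exact: (ball_sub_ball p1 ka hy).
have hlim : prob P (F m) @[m --> \oo] --> prob P (stays a t T) / stay1p t *
  (fine (hitp t (ball k y) (Qp0 p)) -
    p%:R ^ (k - a) * (stay1p t - prob P (stays a 0 t))).
  rewrite FE; apply: cvgM; first exact: later_cvg.
  apply: cvgB; first exact: cvg_cst.
  apply: cvgMr; apply: cvgB; first exact: cvg_cst.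
  exact: stay_grid_cvg.
exact: (cvg_unique _ hF hlim).
Qed.

End Bridge.

(** * Translation of the starting point *)

Section Shift.
Variables (p : nat) (R : realType).
Hypothesis p1 : (1 < p)%N.
Local Notation ball := (Qp_ball R).

Lemma close_ex (x y : Qp p) : exists k : int, Qp_close (- k) x y.
Proof.
exists (- Num.min (lowb x) (lowb y)) => i; rewrite opprK lt_min => /andP[ix iy].
by rewrite !digit_lowb.
Qed.

Lemma close_le (k k' : int) (x y : Qp p) : k <= k' -> Qp_close (- k) x y -> Qp_close (- k') x y.
Proof. by move=> kk h i hi; apply: h; lia. Qed.

Lemma close_trans n (x y z : Qp p) : Qp_close n x y -> Qp_close n y z -> Qp_close n x z.
Proof. by move=> h1 h2 i hi; rewrite h1 // h2. Qed.

Lemma cadlag_locally_bounded (w : Dmeas p R) (x : Qp p) (t : R) : 0 <= t ->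
  exists2 e : R, 0 < e & exists k : int, forall s, 0 <= s -> `|t - s| < e ->
    Qp_close (- k) (Xt s w) x.
Proof.
move=> t0; have [_ rc ll] := proj2_sig w.
have [k hk] := close_ex (Xt t w) x.
have [d d0 hd] := rc t t0 (- k).
have right s : t <= s -> s < t + d -> Qp_close (- k) (Xt s w) x.
  by move=> h1 h2; apply: close_trans hk; apply: hd; rewrite h1.
have := t0; rewrite le_eqVlt => /predU1P[t0E|t_gt0].
  exists d => //; exists k => s s0 hs; apply: right; first by rewrite -t0E.
  by move: hs; rewrite ltr_norml; lra.
have [l hl] := ll t t_gt0; have [k' hk'] := close_ex l x.
have [d' d'0 hd'] := hl (- k').
exists (Num.min d d'); first by rewrite lt_min d0.
exists (Num.max k k') => s s0; rewrite lt_min => /andP[h1 h2].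
have [ts|st] := leP t s.
  apply: (@close_le k); first by rewrite le_max lexx.
  by apply: right => //; move: h1; rewrite ltr_norml; lra.
apply: (@close_le k'); first by rewrite le_max lexx orbT.
apply: close_trans hk'; apply: hd'; rewrite st andbT.
by move: h2; rewrite ltr_norml; lra.
Qed.

(* Boundedness matters because [sup] of an unbounded set is [0]. *)
Lemma cadlag_bounded (w : Dmeas p R) (x : Qp p) (T : R) :
  exists M : R, forall s, 0 <= s <= T -> Qp_abs R (Qp_sub (Xt s w) x) <= M.
Proof.
have /compact_near_coveringP cov := @segment_compact R 0 T.
(* Neighbourhoods of 0 contain negative times, where the path is not controlled; the alternative
   [s < 0] makes the property hold there. *)
have := cov R (pinfty_nbhs R) (fun M s => Qp_abs R (Qp_sub (Xt s w) x) <= M \/ s < 0) _.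
case.
  move=> t; rewrite /= in_itv /= => /andP[t0 _].
  have [e e0 [k hk]] := cadlag_locally_bounded w x t0.
  exists (ball_ Num.norm t e, [set M | p%:R ^ k < M]) => /=.
    split; first exact: nbhsx_ballx.
    by exists (p%:R ^ k); split; first exact: num_real.
  move=> [s M] /= [hs hM]; have [s0|s0] := leP 0 s; last by right.
  left; apply: le_trans (ltW hM); apply/(Qp_abs_le _ p1).
  by apply/(close_sub p1); exact: hk.
move=> M0 [_ hM]; exists (M0 + 1) => s hs.
have : M0 < M0 + 1 by rewrite ltrDl.
move=> /hM /(_ s); rewrite /= in_itv /= hs => /(_ isT)[//|].
by case/andP: hs => s0 _; rewrite ltNge s0.
Qed.

Lemma shift_path (w : Dmeas p R) (x : Qp p) :
  exists w' : Dmeas p R, forall s, Xt s w' = Qp_add (Xt s w) x.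
Proof.
have [h1 h2 h3] := proj2_sig w.
have hc : cadlag (fun s : R => Qp_add (Xt s w) x).
  split.
  - by move=> s s0; rewrite /Xt h1.
  - move=> t t0 n; have [d d0 hd] := h2 t t0 n; exists d; first exact: d0.
    move=> s hs; have := hd s hs; rewrite /Xt; exact: iffRL (close_addr p1 _ _ _ _).
  - move=> t t0; have [l hl] := h3 t t0; exists (Qp_add l x) => n.
    have [d d0 hd] := hl n; exists d; first exact: d0.
    move=> s hs; have := hd s hs; exact: iffRL (close_addr p1 _ _ _ _).
by exists (exist _ _ hc).
Qed.

Lemma supnorm_le (T : R) (x : Qp p) (w : Dmeas p R) (a : int) : 0 <= T ->
  (supnorm T x w <= p%:R ^ a) <->
  forall s, 0 <= s <= T -> Qp_abs R (Qp_sub (Xt s w) x) <= p%:R ^ a.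
Proof.
move=> T0; set S := [set Qp_abs R (Qp_sub (Xt s w) x) | s in `[0, T]].
have S0 : S !=set0.
  by exists (Qp_abs R (Qp_sub (Xt 0 w) x)); exists 0 => //=; rewrite in_itv /= lexx.
split=> h.
  move=> s hs; apply: le_trans h; apply: ub_le_sup.
    have [M hM] := cadlag_bounded w x T; exists M => _ [s' hs' <-].
    by apply: hM; move: hs'; rewrite /= in_itv.
  by exists s => //=; rewrite in_itv.
apply: ge_sup => // _ [s hs <-]; apply: h.
by move: hs; rewrite /= in_itv.
Qed.

(** [Pstart] asks for some translate of [w'] lying in [A]. A translate exists by [shift_path], so an
    equivalence between [w'] and its translates is enough. *)
Lemma Pstart_shift (P : set (Dmeas p R) -> \bar R) (x : Qp p) (A B : set (Dmeas p R)) :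
  (forall w w', (forall s, Xt s w = Qp_add (Xt s w') x) -> (A w <-> B w')) ->
  Pstart P x A = P B.
Proof.
move=> h; rewrite /Pstart; congr (P _); apply/seteqP; split=> w'.
  by move=> [w hA hw]; apply/(h w).
by move=> hB; have [w hw] := shift_path w' x; exists w => //; apply/(h w w').
Qed.

Lemma supnorm_shift (T : R) (x : Qp p) (a : int) (w w' : Dmeas p R) : 0 <= T ->
  (forall s, Xt s w = Qp_add (Xt s w') x) ->
  supnorm T x w <= p%:R ^ a <-> stays a 0 T w'.
Proof.
move=> T0 hw; have hs := supnorm_le x w a T0.
have E s : Qp_abs R (Qp_sub (Xt s w) x) <= p%:R ^ a <-> ball a (Qp0 p) (Xt s w').
  rewrite (Qp_ballE R p1) /= (Qp_abs_le _ p1) hw.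
  have hK : Qp_close (- a) (Qp_sub (Qp_add (Xt s w') x) x) (Xt s w') by exact: close_addK.
  split=> h; last exact: close_trans hK h.
  by move=> i hi; rewrite -hK // h.
split=> [/(iffLR hs) h s sT|h]; first by apply: (iffLR (E s)); exact: h.
by apply: (iffRL hs) => s sT; apply: (iffRL (E s)); exact: h.
Qed.

Lemma at_in_shift (t : R) (x y : Qp p) k (w w' : Dmeas p R) :
  (forall s, Xt s w = Qp_add (Xt s w') x) ->
  ball k y (Xt t w) <-> at_in t (ball k (Qp_sub y x)) w'.
Proof.
by move=> hw; rewrite /at_in /= !(Qp_ballE R p1) /= hw; exact: close_add_sub.
Qed.

End Shift.

(** * Comparison of the bridge with the free process *)

Section Conclusion.
Variables (p : nat) (R : realType) (b sigma : R) (a : int).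
Hypotheses (p1 : (1 < p)%N) (b_gt0 : 0 < b) (sigma_gt0 : 0 < sigma).
Let pR_gt0 : 0 < (p%:R : R). Proof. by rewrite ltr0n ltnW. Qed.
Let pX_gt0 (n : int) : 0 < (p%:R : R) ^ n. Proof. exact: exprz_gt0. Qed.
Local Notation ball := (Qp_ball R).
Local Notation Ba := (ball a (Qp0 p)).
Local Notation hitp := (@hit p R b sigma).
Local Notation stay1p := (stay1 p b sigma a).
Variable P : probability (Dmeas p R) R.
Hypothesis hfdd : forall l : seq (R * set (Qp p)),
  path <%R 0 [seq z.1 | z <- l] -> borel l ->
  P (evt l) = fdd_integral b sigma 0 (Qp0 p) l.
Variables (t T : R).
Hypotheses (t_gt0 : 0 < t) (tT : t <= T).

Lemma measurable_stays alpha beta : 0 <= alpha -> alpha <= beta ->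
  measurable (stays a alpha beta : set (Dmeas p R)).
Proof.
move=> h0 h1; rewrite -(stays_bigcap a p1 h0 h1).
by apply: bigcapT_measurable => m; exact: measurable_grid.
Qed.

Lemma prob_le1 (A : set (Dmeas p R)) : measurable A -> prob P A <= 1.
Proof.
move=> mA; rewrite -lee_fin fineK; first exact: probability_le1.
exact: fin_num_measure.
Qed.

Lemma prob_stays_itv :
  expR (- (sigma * mean_jump p b a * t)) <= prob P (stays a 0 t) <= 1.
Proof.
apply/andP; split; last by apply: prob_le1; exact: (measurable_stays (lexx 0) (ltW t_gt0)).
have hc := stay_grid_cvg p1 b_gt0 sigma_gt0 hfdd t_gt0 (a := a).
apply: (cvgr_to_ge hc); near=> m.
have := stay_ge_exp a p1 b_gt0 sigma_gt0 (grid_path m t_gt0).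
by rewrite grid_rcons cats1 last_rcons subr0.
Unshelve. all: by end_near.
Qed.

Lemma prob_at k y : k <= a -> Ba y ->
  prob P (at_in t (ball k y)) = fine (hitp t (ball k y) (Qp0 p)).
Proof.
move=> ka hy; have pt : path <%R t [::] by [].
have := prob_at_stay p1 b_gt0 sigma_gt0 hfdd t_gt0 pt ka hy.
by rewrite evt_cons evt_nil setIT mulr1.
Qed.

(** The case of [prob_bridge] in which the target is all of [Ba]: the condition at [t] is then
    implied, and S - (S - c) leaves c. *)
Lemma prob_stays_mul :
  prob P (stays a 0 T) = prob P (stays a t T) / stay1p t * prob P (stays a 0 t).
Proof.
have hI : stays a 0 T `&` at_in t Ba = stays a 0 T.
  apply/seteqP; split=> w; first by case.
  by move=> h; split; [exact: h|apply: h; rewrite ltW].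
have := prob_bridge p1 b_gt0 sigma_gt0 hfdd t_gt0 tT (lexx a) (@Qp0_Ba p R a p1).
rewrite hI => ->.
rewrite (hit_Ba p1 b_gt0 sigma_gt0 t_gt0 (@Qp0_Ba p R a p1)) /= subrr expr0z mul1r.
by rewrite subKr.
Qed.

Definition cond_stay (y : Qp p) (n : nat) : R :=
  prob P (stays a 0 T `&` at_in t (ball (- n%:Z) y)) / prob P (at_in t (ball (- n%:Z) y)).

Lemma cond_stay_cvg y : Ba y -> exists2 l : R,
  cond_stay y n @[n --> \oo] --> l & prob P (stays a 0 T) <= l.
Proof.
move=> hy; have [r [r0 hr hc]] := density_limit p1 b_gt0 sigma_gt0 t_gt0 hy.
set c1 := prob P (stays a 0 t); set c2 := prob P (stays a t T) / stay1p t.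
set S := stay1p t in hr c2 *.
exists (c2 * (1 - (S - c1) / r)); last first.
  rewrite prob_stays_mul -/c1 -/c2 ler_wpM2l //.
    by rewrite divr_ge0 ?stay1_ge0 // fine_ge0.
  have := bridge_inequality p1 b_gt0 sigma_gt0 t_gt0 prob_stays_itv hr.
  rewrite -/c1 -/S => h; rewrite lerBrDr -lerBrDl ler_pdivrMr // mulrC.
  exact: h.
(* [u n] is the mean of the normalised density over the n-th ball; once it is positive and the ball
   lies in [Ba], [cond_stay y n] equals [c2 * (1 - (S - c1) / u n)]. *)
set u := (fun n : nat => p%:R ^ a * (p%:R ^ n%:Z * fine (hitp t (ball (- n%:Z) y) (Qp0 p)))) in hc.
have hlim : c2 * (1 - (S - c1) / u n) @[n --> \oo] --> c2 * (1 - (S - c1) / r).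
  apply: cvgM; first exact: cvg_cst.
  apply: cvgB; first exact: cvg_cst.
  apply: cvgM; first exact: cvg_cst.
  by apply: cvgV; [exact: lt0r_neq0|exact: hc].
apply: cvg_trans hlim; apply: near_eq_cvg.
have u0 : \forall n \near \oo, 0 < u n by exact: cvgr_gt hc _ r0.
near=> n.
have un0 : 0 < u n by near: n.
have na : - n%:Z <= a.
  have : (absz a <= n)%N by near: n; exists (absz a).
  by lia.
rewrite /cond_stay (prob_bridge p1 b_gt0 sigma_gt0 hfdd t_gt0 tT na hy) (prob_at na hy).
move: un0; rewrite /u -/c1 -/c2 -/S; move: (fine _) => g; clearbody c1 c2 S.
have -> : p%:R ^ (- n%:Z - a) = ((p%:R : R) ^ a * p%:R ^ n%:Z)^-1.
  by rewrite -expfzDr ?gt_eqF // invr_expz opprD addrC.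
rewrite mulrA; move: (_ * _) (mulr_gt0 (pX_gt0 a) (pX_gt0 n%:Z)) => q q0.
rewrite pmulr_rgt0 // => g0.
by field; rewrite !gt_eqF.
Unshelve. all: by end_near.
Qed.

End Conclusion.

Unset Implicit Arguments. Set Strict Implicit.

Theorem theorem4p9 (p : nat) (hp : prime p) (R : realType)
    (b sigma : R) (hb : 0 < b) (hsigma : 0 < sigma)
    (P : probability (Dmeas p R) R)
    (hP0 : P [set w : Dmeas p R | Xt 0 w = Qp0 p] = 1%E)
    (hfdd : forall l : seq (R * set (Qp p)),
        path <%R 0 [seq z.1 | z <- l] ->
        (forall i, (i < size l)%N -> Qp_borel R (nth (0, setT) l i).2) ->
        P [set w : Dmeas p R | forall i, (i < size l)%N ->
             (nth (0, setT) l i).2 (Xt (nth (0, setT) l i).1 w)]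
        = fdd_integral b sigma 0 (Qp0 p) l)
    (a : int) (T : R) (hT : 0 < T) (x y : Qp p) (hy : Qp_ball R a x y)
    (t : R) (ht : 0 < t <= T) :
  let E := [set w : Dmeas p R | supnorm T x w <= (p%:R : R) ^ a] in
  cvgn (bridge_approx P t x y E) /\
  (Pstart P x E <= (limn (bridge_approx P t x y E))%:E)%E.
Proof.
move=> E; have p1 := prime_gt1 hp; have /andP[t_gt0 tT] := ht.
have hEs (w w' : Dmeas p R) : (forall s, Xt s w = Qp_add (Xt s w') x) ->
    E w <-> stays a 0 T w'.
  by move=> hw; exact: (supnorm_shift p1 a (ltW hT) hw).
have hyy : Qp_ball R a (Qp0 p) (Qp_sub y x).
  by move: hy; rewrite !(Qp_ballE R p1) /= => /(close_sub p1).
have [l hl hle] := cond_stay_cvg p1 hb hsigma hfdd t_gt0 tT hyy.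
have hbr : bridge_approx P t x y E = cond_stay a P t T (Qp_sub y x).
  apply/funext => n; rewrite /bridge_approx /cond_stay /prob; congr (fine _ / fine _).
    apply: (Pstart_shift p1) => w w' hw.
    have h1 := hEs _ _ hw; have h2 := at_in_shift p1 t y (- n%:Z) hw.
    by split=> -[h h']; split;
      [exact: (iffLR h1)|exact: (iffLR h2)|exact: (iffRL h1)|exact: (iffRL h2)].
  by apply: (Pstart_shift p1) => w w' hw; apply: at_in_shift.
have hP : Pstart P x E = P (stays a 0 T) by exact: Pstart_shift.
rewrite hbr; split; first by apply/cvg_ex; exists l.
rewrite (cvg_lim _ hl) // hP -[X in (X <= _)%E]fineK ?lee_fin //.
by apply: fin_num_measure; apply: (measurable_stays a p1 (lexx 0) (ltW hT)).
Qed.
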